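(* For every $1\leq q<\infty$ and every $C>0$ there exists a weakly differentiable function $f:\mathbb{R}\rightarrow\mathbb{R}$ with only one local maximum such that \[ \sup_{\lambda>0}\lambda\,\mathcal{L}\bigl(\{x\in\mathbb{R}:|(\mathcal{M}f)''(x)|>\lambda\}\bigr)>C\operatorname{var}(f') \] and \[ \operatorname{var}^q((\mathcal{M}f)')>C\operatorname{var}^q(f'). \]
   Context: The uncentered Hardy-Littlewood maximal function (defined without absolute values) of $f:\mathbb{R}\to\mathbb{R}$ is \[ \mathcal{M}f(x)=\sup_{a<x<b}\frac1{b-a}\int_a^b f(y)\,\mathrm{d}y . \] The function $f$ is locally integrable and $\mathcal{M}f$ is real-valued and weakly differentiable, so that $(\mathcal{M}f)'$ makes sense; $(\mathcal{M}f)''(x)$ denotes the pointwise second derivative at the points $x$ where it exists. $\mathcal{L}$ denotes Lebesgue measure on $\mathbb{R}$. For a locally integrable $g$ on $\mathbb{R}$, \[ \operatorname{var}(g)=\sup\Bigl\{-\int_{\mathbb{R}}g\varphi':\varphi\in C^1_{\mathrm c}(\mathbb{R}),\ |\varphi|\leq1\Bigr\}. \] Let $\mathbb{R}_g$ denote the set of points of approximate continuity of $g$. For $1\leq q<\infty$, \[ \operatorname{var}^q(g)=\sup\Bigl\{\sum_{i=1}^m|g(x_{i+1})-g(x_i)|^q: m\in\mathbb{N},\ x_i\in\mathbb{R}_g,\ x_1<\ldots<x_{m+1}\Bigr\}^{1/q}. \] One has $\operatorname{var}^1=\operatorname{var}$. *)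

(* Defs.v *)
From HB Require Import structures.
From mathcomp Require Import all_boot all_order all_algebra.
From mathcomp Require Import all_classical all_reals all_analysis.
Set Implicit Arguments.
Unset Strict Implicit.
Unset Printing Implicit Defensive.
Import Order.TTheory GRing.Theory Num.Theory.
Import numFieldNormedType.Exports.
Local Open Scope classical_set_scope.
Local Open Scope ring_scope.

Definition leb {R : realType} : set R -> \bar R := @lebesgue_measure R.

Definition uncentered_maximal {R : realType} (f : R -> R) (x : R) : \bar R :=
  ereal_sup [set z | exists a b : R, [/\ a < x, x < b &
    z = ((b - a)^-1 * \int[@lebesgue_measure R]_(y in `[a, b]) f y)%:E]].

Definition C1_compact_support {R : realType} (phi : R -> R) : Prop :=
  [/\ forall x, derivable phi x 1, continuous (derive1 phi) &
      compact (closure [set x | phi x != 0])].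

(* [g] is a representative of the almost-everywhere class of the weak
   derivative of [f]. *)
Definition is_weak_derivative {R : realType} (f g : R -> R) : Prop :=
  [/\ locally_integrable setT f, locally_integrable setT g &
      forall phi : R -> R, C1_compact_support phi ->
        \int[@lebesgue_measure R]_x (f x * derive1 phi x) =
        - \int[@lebesgue_measure R]_x (g x * phi x)].

Definition var {R : realType} (g : R -> R) : \bar R :=
  ereal_sup [set z | exists phi : R -> R,
    [/\ C1_compact_support phi, forall x, `|phi x| <= 1 &
        z = (- \int[@lebesgue_measure R]_x (g x * derive1 phi x))%:E]].

Definition approx_continuous_at {R : realType} (g : R -> R) (x : R) : Prop :=
  forall eps : R, 0 < eps ->
    (fun r : R => fine (leb (ball x r `&` [set y | eps <= `|g y - g x|]))
                  / (2 * r)) @ 0^'+ --> (0 : R).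

(* The points x_1 < ... < x_{m+1} are numbered from 0 to m. *)
Definition varq {R : realType} (q : R) (g : R -> R) : \bar R :=
  poweR (ereal_sup [set z | exists (m : nat) (x : nat -> R),
    [/\ forall i, (i <= m)%N -> approx_continuous_at g (x i),
        forall i, (i < m)%N -> x i < x i.+1 &
        z = (\sum_(i < m) `|g (x i.+1) - g (x i)| `^ q)%:E]]) q^-1.

(* [derivable] is required explicitly because [derive1] is total. *)
Definition second_derivative_superlevel {R : realType} (h : R -> R) (lam : R) :
    set R :=
  [set x | [/\ \forall y \near x, derivable h y 1, derivable (derive1 h) x 1 &
               lam < `|derive1n 2 h x|]].

Definition weak_L1_second_derivative {R : realType} (h : R -> R) : \bar R :=
  ereal_sup [set (lam%:E * leb (second_derivative_superlevel h lam))%E |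
             lam in [set lam : R | 0 < lam]].

Definition local_maximum {R : realType} (f : R -> R) (x : R) : Prop :=
  \forall y \near x, f y <= f x.

(* Main.v *)
Require Import Defs.
From HB Require Import structures.
From mathcomp Require Import all_boot all_order all_algebra.
From mathcomp Require Import all_classical all_reals all_analysis.
From mathcomp Require Import measurable_realfun ring lra.
Import Order.TTheory GRing.Theory Num.Theory.
Import numFieldNormedType.Exports.
Local Open Scope classical_set_scope.
Local Open Scope ring_scope.

Set Implicit Arguments.
Unset Strict Implicit.
Unset Printing Implicit Defensive.

(** The function is a peak with top at [0]: it is [- y] for [y >= 0] and
[- g (- y)] for [y <= 0], where the profile [g] vanishes at [0] and increases
with slope [e ^ 2], except on [K] treads [4 ^ k <= s <= 2 * 4 ^ k] on which it
is almost constant.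

For [x > 0] the supremum defining the maximal function [Mf] is approached on
an interval [-s, x] whose left endpoint satisfies [f (- s) = Mf x]; write
[s = foot x] and [depth x = - Mf x = g s]. The envelope inequality
[depth_envelope] yields [Mf' x = - (x - depth x) / (x + foot x)] without
differentiating [foot]. When [foot x] runs through a tread, [depth x], and
therefore [x], hardly move while [foot x] doubles; since [x] is of the order of
[e * foot x], the derivative [Mf'] changes by an amount of order [e]
([tread_jump]). The two corners of [f] that bound a tread contribute only
order [e ^ 2] to the variation of [f'].

So the [q]-variations to the power [q] compare as [K * (e / 10) ^ q] for [Mf']
against [2 ^ q + 2 * K * e ^ (2 * q)] for [f']; the isolated term [2 ^ q] is the
jump of [f'] at the top of the peak. A small [e], followed by a large [K], makes
the quotient as large as desired.

For the weak norm of [Mf''] all treads have to be seen by one and the same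
level [lambda]. The slope on the tread at scale [4 ^ k] is taken proportional to
[4 ^ - k], which compensates for the scale: on each tread [Mf''] is at least [1]
([second_slope_ge1]) along an interval of length at least [e / 400]
([tread_width]). The level [1 / 2] thus gives at least [K * e / 800], against
[2 + 2 * K * e ^ 2] for the variation of [f'].

The maximal function is linear on each side of [0] near [0] and continuously
differentiable elsewhere, so it is the sum of a function of class C1 and a
multiple of a ramp; the peak itself is a combination of ramps. Weak derivatives
and the bound on the variation of [f'] therefore reduce to integration by parts
against functions of class C1. *)

(** * The optimal interval to the right of the top *)

(** [g] is the profile of the peak to the left of its top, read from right to
left and upside down, and [G] is its primitive. Linearity up to [1] makes the
maximal function linear near [0] on both sides; the lower bound [m] on the
slopes makes [g] invertible with a continuous inverse. *)
Record left_profile {R : realType} (g G : R -> R) (m ep : R) : Prop :=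
  LeftProfile {
    lp_m_gt0 : 0 < m;
    lp_ep_le1 : ep <= 1;
    lp_deriv : forall s, is_derive s (1 : R) G (g s);
    lp_lb : forall u v, u <= v -> m * (v - u) <= g v - g u;
    lp_ub : forall u v, u <= v -> g v - g u <= ep * (v - u);
    lp_lin : forall s, s <= 1 -> g s = ep * s;
    lp_quad : forall s, s <= 1 -> G s = ep * s ^+ 2 / 2 }.

Section foot.
Context {R : realType}.
Implicit Types (g G : R -> R).

(** The mean of the peak over [-s, x] equals its value [- g s] at the left
endpoint: this is the condition for [s] to be optimal. *)
Definition foot_eq g G (x s : R) := (x + s) * g s = G s + x ^+ 2 / 2.

Definition foot g G (x : R) : R := xget 0 [set s | 0 < s /\ foot_eq g G x s].

(** The maximal function at [x > 0] is [- depth g G x], see [peak_max_right]. *)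
Definition depth g G (x : R) : R := g (foot g G x).

End foot.

Section left_profile_theory.
Context {R : realType} {g G : R -> R} {m ep : R}.
Hypothesis H : left_profile g G m ep.

Let m_gt0 : 0 < m := lp_m_gt0 H.
Let ep_le1 : ep <= 1 := lp_ep_le1 H.

Local Notation foot_eq := (foot_eq g G).
Local Notation foot := (foot g G).
Local Notation depth := (depth g G).

Lemma lp0 : g 0 = 0.
Proof. by rewrite (lp_lin H) ?mulr0. Qed.

Lemma lpG0 : G 0 = 0.
Proof. by rewrite (lp_quad H)// expr0n/= mulr0 mul0r. Qed.

Lemma lp_ep_gt0 : 0 < ep.
Proof.
have := lp_lb H ler01.
by rewrite lp0 (lp_lin H)// subr0 !mulr1 subr0 => /(lt_le_trans m_gt0).
Qed.

Lemma lp_lip u v : u <= v -> g v - g u <= v - u.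
Proof.
move=> uv; apply: le_trans (lp_ub H uv) _.
by rewrite ler_piMl ?subr_ge0.
Qed.

Lemma lp_homo u v : u <= v -> g u <= g v.
Proof.
move=> uv; rewrite -subr_ge0; apply: le_trans (lp_lb H uv).
by rewrite mulr_ge0 ?subr_ge0// ltW.
Qed.

Lemma lp_homo_lt u v : u < v -> g u < g v.
Proof.
move=> uv; rewrite -subr_gt0; apply: lt_le_trans (lp_lb H (ltW uv)).
by rewrite mulr_gt0 ?subr_gt0.
Qed.

Lemma lp_cont : continuous g.
Proof.
move=> x; apply/cvgrPdist_lt => e e0; near=> y.
have xye : `|x - y| < e by near: y; apply: cvgr_dist_lt.
apply: le_lt_trans xye.
have [xy|/ltW yx] := leP x y.
  by rewrite !(distrC x, distrC (g x)) !ger0_norm ?subr_ge0 ?lp_homo ?lp_lip.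
by rewrite !ger0_norm ?subr_ge0 ?lp_homo ?lp_lip.
Unshelve. all: by end_near. Qed.

Lemma lpG_cont : continuous G.
Proof.
by move=> x; apply/differentiable_continuous/derivable1_diffP; case: (lp_deriv H x).
Qed.

(** [G] is convex, because its derivative [g] is increasing. *)
Lemma lp_tangent u v : G u + g u * (v - u) <= G v.
Proof.
have [uv|/ltW vu] := leP u v.
  have [c] := @MVT_segment R G g u v uv (fun x _ => lp_deriv H x)
    (continuous_subspaceT lpG_cont).
  rewrite in_itv/= => /andP[uc cv] E.
  by have := lp_homo uc; nra.
have [c] := @MVT_segment R G g v u vu (fun x _ => lp_deriv H x)
  (continuous_subspaceT lpG_cont).
rewrite in_itv/= => /andP[uc cv] E.
by have := lp_homo cv; nra.
Qed.

(** The two sides of [foot_eq] differ by a strictly increasing function of the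
endpoint, which is why it has a unique solution. *)
Lemma foot_homo x u v : 0 < x -> 0 <= u -> u < v ->
  (x + u) * g u - G u < (x + v) * g v - G v.
Proof.
move=> x0 u0 uv; have := lp_tangent v u; have := lp_homo_lt uv.
by nra.
Qed.

Lemma foot_exists x : 0 < x -> exists2 s, 0 < s & foot_eq x s.
Proof.
move=> x0; pose D s := (x + s) * g s - G s.
have xm : 0 <= x / (2 * m) by rewrite divr_ge0 ?mulr_ge0// ltW.
have [||s] := @IVT R D 0 (x / (2 * m)) (x ^+ 2 / 2) xm.
- apply: continuous_subspaceT => z; apply: cvgB; last exact: lpG_cont.
  by apply: cvgM; [apply: cvgD; [exact: cvg_cst|exact: cvg_id]|exact: lp_cont].
- have D0 : D 0 = 0 by rewrite /D lp0 lpG0 mulr0 subr0.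
  have D1 : x ^+ 2 / 2 <= D (x / (2 * m)).
    rewrite /D; set s := x / _.
    have -> : x ^+ 2 / 2 = x * (m * s) by rewrite /s; field; rewrite gt_eqF.
    have := lp_tangent s 0; have := lp_lb H xm.
    rewrite -/s lp0 lpG0 !subr0 => h1 h2.
    have : x * (m * s) <= x * g s by rewrite ler_pM2l.
    by lra.
  by rewrite D0 ge_min le_max D1 orbT andbT divr_ge0// sqr_ge0.
- rewrite in_itv/= => /andP[s0 _] Ds; exists s; last first.
    by rewrite /foot_eq -Ds /D; ring.
  rewrite lt_neqAle s0 andbT; apply/eqP => s0'; move: Ds.
  rewrite /D -s0' lp0 lpG0 mulr0 subr0 => /esym/eqP.
  by rewrite gt_eqF// divr_gt0// exprn_gt0.
Qed.

Lemma footP x : 0 < x -> 0 < foot x /\ foot_eq x (foot x).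
Proof.
move=> /foot_exists[s s0 sE]; rewrite /foot.
by case: xgetP => [_ -> //|/(_ s)]; case.
Qed.

Lemma foot_gt0 x : 0 < x -> 0 < foot x. Proof. by case/footP. Qed.

Lemma foot_unique x s : 0 < x -> 0 <= s -> foot_eq x s -> foot x = s.
Proof.
move=> x0 s0 sE; have [f0 fE] := footP x0.
case: (ltgtP (foot x) s) => // lt_; exfalso.
- by have := foot_homo x0 (ltW f0) lt_; move: sE fE; rewrite /foot_eq; lra.
- by have := foot_homo x0 s0 lt_; move: sE fE; rewrite /foot_eq; lra.
Qed.

Lemma depth_gt0 x : 0 < x -> 0 < depth x.
Proof. by move=> /foot_gt0 /lp_homo_lt; rewrite lp0. Qed.

Lemma depth_le x : 0 < x -> depth x <= x / 2.
Proof.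
move=> x0; have [f0] := footP x0; rewrite /foot_eq -/(depth x) => fE.
have := lp_tangent (foot x) 0; rewrite lpG0 -/(depth x) => h.
by rewrite -(ler_pM2l x0); nra.
Qed.

(** [- depth y] is a supremum of means, and here it is compared with the mean over
the interval that is optimal for [x] but with right endpoint [y]. Exchanging [x]
and [y] bounds the difference quotient of [depth] from both sides by quantities
with the same limit. *)
Lemma depth_envelope x y : 0 < x -> 0 < y ->
  (depth y - depth x) * (y + foot x) <= (y - x) * ((x + y) / 2 - depth x).
Proof.
move=> x0 y0; have [fx0] := footP x0; have [fy0] := footP y0.
rewrite /foot_eq -!/(depth _) => Ey Ex.
have := lp_tangent (foot y) (foot x); rewrite -/(depth y) => h.
by nra.
Qed.

Lemma depth_incr x y : 0 < x -> x < y -> depth x < depth y.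
Proof.
move=> x0 xy; have y0 := lt_trans x0 xy.
have := depth_envelope y0 x0; have := depth_le y0.
have := foot_gt0 y0; have := foot_gt0 x0 => fx fy dy h.
have h2 : 0 < (depth y - depth x) * (x + foot y) by nra.
by move: h2; rewrite pmulr_lgt0 ?subr_gt0// addr_gt0.
Qed.

Lemma foot_incr x y : 0 < x -> x < y -> foot x < foot y.
Proof.
move=> x0 xy; rewrite ltNge; apply/negP => /lp_homo.
by rewrite -/(depth x) -/(depth y) leNgt depth_incr.
Qed.

Lemma depth_lip x y : 0 < x -> x <= y -> depth y - depth x <= y - x.
Proof.
move=> x0 xy; have y0 := lt_le_trans x0 xy.
have := depth_envelope x0 y0; have := depth_gt0 x0; have := foot_gt0 x0.
move=> fx dx h; rewrite -(ler_pM2r (_ : 0 < y + foot x)) ?addr_gt0//.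
by apply: (le_trans h); rewrite ler_wpM2l ?subr_ge0//; lra.
Qed.

Lemma depth_cont x : 0 < x -> {for x, continuous depth}.
Proof.
move=> x0; apply/cvgrPdist_lt => e e0; near=> y.
have y0 : 0 < y by near: y; exact: lt_nbhsr.
have xye : `|x - y| < e by near: y; apply: cvgr_dist_lt.
apply: le_lt_trans xye; have [xy|yx|<-] := ltgtP x y; last by rewrite !subrr.
  have h1 := depth_lip x0 (ltW xy); have h2 := ltW (depth_incr x0 xy).
  by rewrite (distrC x) (distrC (depth x)) !ger0_norm// subr_ge0// ltW.
have h1 := depth_lip y0 (ltW yx); have h2 := ltW (depth_incr y0 yx).
by rewrite !ger0_norm// subr_ge0// ltW.
Unshelve. all: by end_near. Qed.

(** The slopes of [g] are bounded below, so the continuity of [depth = g \o foot]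
passes to [foot]. *)
Lemma foot_cont x : 0 < x -> {for x, continuous foot}.
Proof.
move=> x0; apply/cvgrPdist_lt => e e0; near=> y.
have y0 : 0 < y by near: y; exact: lt_nbhsr.
have xye : `|depth x - depth y| < m * e.
  near: y; apply: cvgr_dist_lt; [exact: depth_cont|exact: mulr_gt0].
rewrite -(ltr_pM2l m_gt0); apply: le_lt_trans xye.
have [/[dup] xy /(lp_lb H) h|/ltW /[dup] xy /(lp_lb H) h] := leP (foot x) (foot y).
  rewrite (distrC (foot x)) (distrC (depth x)).
  by rewrite !ger0_norm// subr_ge0//; exact: lp_homo.
by rewrite !ger0_norm// subr_ge0//; exact: lp_homo.
Unshelve. all: by end_near. Qed.

Lemma depth_is_derive (x : R) : 0 < x ->
  is_derive x (1:R) depth ((x - depth x) / (x + foot x)).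
Proof.
move=> x0.
pose A y := ((x + y) / 2 - depth x) / (y + foot x).
pose B y := ((x + y) / 2 - depth y) / (x + foot y).
set tau := (_ / _).
have fx0 := foot_gt0 x0.
have cx : (fun y : R => (x + y) / 2) @ x --> x.
  have : (fun y : R => (x + y) / 2) @ x --> (x + x) / 2.
    by apply: cvgM; [apply: cvgD; [exact: cvg_cst|exact: cvg_id]|exact: cvg_cst].
  by rewrite (_ : (x + x) / 2 = x) //; field.
have cA : A @ x --> tau.
  apply: cvgM; first by apply: cvgB; [exact: cx|exact: cvg_cst].
  by apply: cvgV; [rewrite gt_eqF// addr_gt0|apply: cvgD; [exact: cvg_id|exact: cvg_cst]].
have cB : B @ x --> tau.
  apply: cvgM; first by apply: cvgB; [exact: cx|exact: depth_cont].
  by apply: cvgV; [rewrite gt_eqF// addr_gt0|apply: cvgD; [exact: cvg_cst|exact: foot_cont]].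
have main : (fun h : R => h^-1 *: (depth (h *: (1:R) + x) - depth x)) @ 0^' --> tau.
  apply/cvgrPdist_lt => e e0.
  have e20 : 0 < e / 2 by rewrite divr_gt0.
  have /cvgrPdist_lt/(_ _ e20) hA := cA.
  have /cvgrPdist_lt/(_ _ e20) hB := cB.
  have cshift : (fun h : R => h *: (1:R) + x) @ 0^' --> x.
    have : (fun h : R => h *: (1:R) + x) @ 0^' --> (0:R) *: (1:R) + x.
      apply: cvg_within_filter; apply: cvgD; last exact: cvg_cst.
      by apply: cvgZr_tmp; exact: cvg_id.
    by rewrite scale0r add0r.
  near=> h.
  have h0 : h != 0 by near: h; exact: nbhs_dnbhs_neq.
  have y0 : 0 < h *: (1:R) + x.
    by near: h; apply: (cshift [set y | 0 < y]); exact: lt_nbhsr.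
  have yA : `|tau - A (h *: (1:R) + x)| < e / 2.
    by near: h; exact: (cshift [set y | `|tau - A y| < e / 2]).
  have yB : `|tau - B (h *: (1:R) + x)| < e / 2.
    by near: h; exact: (cshift [set y | `|tau - B y| < e / 2]).
  set y := h *: (1:R) + x in y0 yA yB *.
  have fy0 := foot_gt0 y0.
  have hE : y - x = h by rewrite /y /GRing.scale/= mulr1 addrK.
  have E1 := depth_envelope x0 y0; have E2 := depth_envelope y0 x0.
  have pA : 0 < y + foot x by rewrite addr_gt0.
  have pB : 0 < x + foot y by rewrite addr_gt0.
  rewrite hE in E1; have hE' : x - y = - h by rewrite -hE opprB.
  rewrite hE' in E2.
  have E1' : depth y - depth x <= h * A y by rewrite /A mulrA ler_pdivlMr.
  have E2' : h * B y <= depth y - depth x.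
    by rewrite /B mulrA ler_pdivrMr//; nra.
  set q := _ *: _.
  have qE : depth y - depth x = h * q by rewrite /q /GRing.scale/= mulrA mulfV// mul1r.
  rewrite qE in E1' E2'.
  move: yA yB; rewrite !ltr_norml => /andP[a1 a2] /andP[b1 b2].
  have [h_gt0|h_lt0] : 0 < h \/ h < 0 by case: (ltgtP h 0) h0 => //; [right|left].
    by move: E1' E2'; rewrite !ler_pM2l// => ? ?; apply/andP; split; lra.
  by move: E1' E2'; rewrite !ler_nM2l// => ? ?; apply/andP; split; lra.
apply: DeriveDef.
  by apply/cvg_ex; exists tau.
exact: cvg_lim main.
Unshelve. all: by end_near. Qed.

End left_profile_theory.

(** * The peak and its maximal function *)

Definition ramp {R : realType} (x : R) : R := Num.max x 0.

Section ramp_theory.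
Context {R : realType}.
Implicit Types x y : R.

Lemma ramp_pos x : 0 <= x -> ramp x = x.
Proof. by move=> x0; rewrite /ramp max_l. Qed.

Lemma ramp_neg x : x <= 0 -> ramp x = 0.
Proof. by move=> x0; rewrite /ramp max_r. Qed.

Lemma ramp_continuous : continuous (@ramp R).
Proof.
move=> x; apply: (@continuous_max R R id (cst 0)); [exact: cvg_id|exact: cvg_cst].
Qed.

Lemma is_derive_ramp_sqr (x : R) :
  is_derive x (1 : R) (fun y : R => ramp y ^+ 2 / 2) (ramp x).
Proof.
have [x0|x0|->] := ltgtP x 0.
- rewrite ramp_neg ?ltW//; apply: (@near_eq_is_derive _ _ _ (cst 0)).
  by near=> y; rewrite ramp_neg ?expr0n ?mul0r//; apply/ltW; near: y; exact: lt_nbhsl.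
- rewrite ramp_pos ?ltW//; apply: (@near_eq_is_derive _ R R (fun y : R => y ^+ 2 / 2)).
    by near=> y; rewrite ramp_pos//; apply/ltW; near: y; exact: lt_nbhsr.
  by apply: is_derive_eq; rewrite /GRing.scale/=; field.
- rewrite ramp_neg//.
  have main : (fun h : R => h^-1 *: (ramp (h *: (1:R) + 0) ^+ 2 / 2 - ramp (0:R) ^+ 2 / 2)) @ 0^' --> (0:R).
    apply/cvgrPdist_lt => e e0; near=> h.
    have h0 : h != 0 by near: h; exact: nbhs_dnbhs_neq.
    have he : `|h| < e by near: h; exact: dnbhs0_lt.
    apply: le_lt_trans he; rewrite addr0 /GRing.scale/= mulr1 (ramp_neg (lexx _)).
    rewrite expr0n/= mul0r subr0 sub0r normrN.
    have [hp|hn] := leP 0 h.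
      rewrite ramp_pos// (_ : h^-1 * (h ^+ 2 / 2) = h / 2); last by field.
      by rewrite !ger0_norm ?divr_ge0//; lra.
    by rewrite (ramp_neg (ltW hn)) expr0n/= mul0r mulr0 normr0 normr_ge0.
  by apply: DeriveDef; [apply/cvg_ex; exists 0|exact: cvg_lim main].
Unshelve. all: by end_near. Qed.

End ramp_theory.

(** To the right of [0] the profile is linear with slope [ep], so that the term
[- g (- y)] is [ep * y] there and the ramp corrects the slope to [- 1]. *)
Definition peak {R : realType} (g : R -> R) (ep y : R) : R :=
  - g (- y) - (1 + ep) * ramp y.

Definition peak_prim {R : realType} (G : R -> R) (ep y : R) : R :=
  G (- y) - (1 + ep) * (ramp y ^+ 2 / 2).

Definition peak_max {R : realType} (g G : R -> R) (x : R) : R :=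
  if x <= 0 then - x - Num.sqrt (x ^+ 2 + 2 * G (- x)) else - depth g G x.

(** The mean value of an optimal interval need only be approached: the intervals in
[uncentered_maximal] contain [x] in their interior, while for [x != 0] the optimal
one has [x] as an endpoint. *)
Lemma maximal_eq {R : realType} (f P : R -> R) (x m : R) :
  continuous f -> (forall y : R, is_derive y (1 : R) P (f y)) ->
  (forall a b, a < x -> x < b -> P b - P a <= m * (b - a)) ->
  (forall e, 0 < e -> exists a b,
      [/\ a < x, x < b & (m - e) * (b - a) <= P b - P a]) ->
  uncentered_maximal f x = m%:E.
Proof.
move=> fc fP ub lb.
have intE a b : a < b -> \int[@lebesgue_measure R]_(y in `[a, b]) f y = P b - P a.
  move=> ab; rewrite /Rintegral (@continuous_FTC2 _ f P a b)//.
  - exact: continuous_subspaceT.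
  - have Pc : continuous P.
      by move=> z; apply/differentiable_continuous/derivable1_diffP; case: (fP z).
    split=> [z _||]; first by case: (fP z).
    + by apply: cvg_at_right_filter; exact: Pc.
    + by apply: cvg_at_left_filter; exact: Pc.
  - by move=> z _; rewrite derive1E; case: (fP z).
apply/eqP; rewrite eq_le; apply/andP; split.
  apply: ge_ereal_sup => _ [a [b [ax xb ->]]]; have ab := lt_trans ax xb.
  by rewrite lee_fin intE// mulrC ler_pdivrMr ?subr_gt0// ub.
apply/lee_addgt0Pr => e e0; have [a [b [ax xb h]]] := lb _ e0.
rewrite -leeBlDr// -EFinB.
apply: (@le_trans _ _ ((b - a)^-1 * \int[@lebesgue_measure R]_(y in `[a, b]) f y)%:E).
  have ab := lt_trans ax xb.
  by rewrite lee_fin intE// [leRHS]mulrC ler_pdivlMr ?subr_gt0.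
by apply: ereal_sup_ubound; exists a, b; split.
Qed.

Section peak_theory.
Context {R : realType} {g G : R -> R} {m ep : R}.
Hypothesis H : left_profile g G m ep.

Let m_gt0 : 0 < m := lp_m_gt0 H.
Let ep_gt0 : 0 < ep := lp_ep_gt0 H.

Notation f := (peak g ep).
Notation P := (peak_prim G ep).

Lemma peak_pos y : 0 <= y -> f y = - y.
Proof.
move=> y0; rewrite /peak ramp_pos// (lp_lin H) ?mulrN; last by lra.
ring.
Qed.

Lemma peak_neg y : y <= 0 -> f y = - g (- y).
Proof. by move=> y0; rewrite /peak ramp_neg// mulr0 subr0. Qed.

Lemma peak_cont : continuous f.
Proof.
move=> y; apply: cvgB; last by apply: cvgM; [exact: cvg_cst|exact: ramp_continuous].
apply: cvgN; apply: (@continuous_comp _ _ _ -%R g); first exact: opp_continuous.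
exact: lp_cont H _.
Qed.

Lemma peak_prim_pos y : 0 <= y -> P y = - (y ^+ 2 / 2).
Proof.
move=> y0; rewrite /peak_prim ramp_pos// (lp_quad H) ?sqrrN; last by lra.
by field.
Qed.

Lemma peak_prim_neg y : y <= 0 -> P y = G (- y).
Proof. by move=> y0; rewrite /peak_prim ramp_neg// expr0n/= mul0r mulr0 subr0. Qed.

Lemma peak_is_derive (y : R) : is_derive y (1 : R) P (f y).
Proof.
have d1 : is_derive y (1 : R) (G \o -%R) (g (- y) * (- 1)).
  by apply: is_derive1_comp; exact: lp_deriv H _.
have d2 := is_deriveZ (1 + ep) (is_derive_ramp_sqr y).
have := is_deriveB d1 d2; rewrite mulrN1 -[_ *: _]/(_ * _).
exact.
Qed.

Lemma peak_prim_cont : continuous P.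
Proof.
by move=> z; apply/differentiable_continuous/derivable1_diffP; case: (peak_is_derive z).
Qed.

Lemma peak_max_approx (x a b t : R) : a <= x -> x <= b -> a < b ->
  P b - P a = t * (b - a) -> forall e, 0 < e -> exists a' b',
      [/\ a' < x, x < b' & (t - e) * (b' - a') <= P b' - P a'].
Proof.
move=> ax xb ab E e e0.
pose Q d := P (b + d) - P (a - d) - (t - e) * (b + d - (a - d)).
have Q0 : 0 < Q 0.
  rewrite /Q !addr0 !subr0 E; have : 0 < e * (b - a) by rewrite mulr_gt0 ?subr_gt0.
  by lra.
have cQ : Q @ 0 --> Q 0.
  have cb : (fun d : R => b + d) @ 0 --> b + 0 by apply: cvgD; [exact: cvg_cst|exact: cvg_id].
  have ca : (fun d : R => a - d) @ 0 --> a - 0 by apply: cvgB; [exact: cvg_cst|exact: cvg_id].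
  apply: cvgB; last by apply: cvgM; [exact: cvg_cst|exact: cvgB].
  apply: cvgB.
    by apply: (@cvg_comp _ _ _ (fun d : R => b + d) P _ _ _ cb); exact: peak_prim_cont.
  by apply: (@cvg_comp _ _ _ (fun d : R => a - d) P _ _ _ ca); exact: peak_prim_cont.
near (0:R)^'+ => d.
have d0 : 0 < d by [].
have Qd : 0 < Q d by near: d; exact: (cvg_at_right_filter cQ (lt_nbhsr Q0)).
by exists (a - d), (b + d); split; [lra|lra|move: Qd; rewrite /Q; lra].
Unshelve. all: by end_near. Qed.

(** With [t = depth x] and [s = foot x], the function [I y = P y + t * y] is a
primitive of [f + t]; it decreases up to [- s], increases up to [t] and decreases
from there on, and [I (- s) = I x]. As [t <= x], this gives [I b <= I x <= I a]
whenever [a < x < b], which says that the mean of [f] over [a, b] is at most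
[- t]. *)
Lemma peak_max_right x : 0 < x -> uncentered_maximal f x = (- depth g G x)%:E.
Proof.
move=> x0; have [s0] := footP H x0; have t2 := depth_le H x0.
have t0 := depth_gt0 H x0.
rewrite /foot_eq -/(depth g G x).
move: t0 t2 s0; have := @lp_tangent _ _ _ _ _ H (foot g G x); rewrite -/(depth g G x).
move: (foot g G x) (depth g G x) => s t tan t0 tx s0 E.
have tan0 := tan 0; rewrite (lpG0 H) in tan0.
apply: (maximal_eq peak_cont peak_is_derive).
- move=> a b ax xb; rewrite (peak_prim_pos (_ : 0 <= b)); last by lra.
  have hb : 0 <= (b - x) * ((b + x) / 2 - t) by rewrite mulr_ge0//; lra.
  have [a0|a0] := leP a 0.
    by rewrite peak_prim_neg//; have := tan (- a); nra.
  rewrite peak_prim_pos ?ltW//.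
  have [at_|ta] := leP a t; first by nra.
  have ha : 0 <= (x - a) * ((x + a) / 2 - t) by rewrite mulr_ge0//; lra.
  by nra.
- apply: (@peak_max_approx x (- s) x (- t)); rewrite ?lexx//; [lra|lra|].
  rewrite (peak_prim_pos (ltW x0)) peak_prim_neg; last by lra.
  by rewrite !opprK; lra.
Qed.

Lemma lpG_ge0 y : 0 <= y -> 0 <= G y.
Proof.
by move=> y0; have := lp_tangent H 0 y; rewrite (lpG0 H) (lp0 H) mul0r addr0.
Qed.

Lemma lpG_gt0 y : 0 < y -> 0 < G y.
Proof.
move=> y0; have h2 : 0 < y / 2 by rewrite divr_gt0.
have := lp_tangent H (y / 2) y; apply: lt_le_trans.
apply: ltr_wpDl; first exact/lpG_ge0/ltW.
rewrite mulr_gt0//; last by lra.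
by rewrite -(lp0 H) (lp_homo_lt H).
Qed.

(** Here the optimal interval is [x, t], where [- t] is both the mean over it and
the value of the peak at its right endpoint; solving the quadratic equation for
[t] yields the square root. *)
Lemma peak_max_left x : x < 0 ->
  uncentered_maximal f x = (- x - Num.sqrt (x ^+ 2 + 2 * G (- x)))%:E.
Proof.
rewrite -(opprK x); move: (- x) => {x} y; rewrite oppr_lt0 => y0.
rewrite !opprK sqrrN.
have Gy := lpG_gt0 y0.
have [S0 SE] : 0 <= Num.sqrt (y ^+ 2 + 2 * G y) /\
   Num.sqrt (y ^+ 2 + 2 * G y) ^+ 2 = y ^+ 2 + 2 * G y.
  by split; [exact: sqrtr_ge0|rewrite sqr_sqrtr// addr_ge0 ?sqr_ge0// mulr_ge0// ltW].
move: S0 SE; set S := Num.sqrt _ => S0 SE.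
pose t := S - y; have -> : y - S = - t by rewrite opprB.
have tE : t ^+ 2 + 2 * (t * y) = 2 * G y by rewrite /t; nra.
have t0 : 0 < t by rewrite subr_gt0 -(ltr_pXn2r (n:=2)) ?nnegrE// ?(ltW y0)// SE; lra.
have tan0 := lp_tangent H y 0; rewrite (lpG0 H) in tan0.
have tg : t <= g y by nra.
apply: (maximal_eq peak_cont peak_is_derive).
- move=> a b ax xb; rewrite (peak_prim_neg (_ : a <= 0)); last by lra.
  have ha : G y - t * y <= G (- a) + t * a.
    have := lp_tangent H y (- a); have : 0 <= (g y - t) * (- a - y) by rewrite mulr_ge0//; lra.
    by lra.
  suff hb : P b + t * b <= t ^+ 2 / 2 by lra.
  have [b0|b0] := leP 0 b.
    by rewrite peak_prim_pos//; have := sqr_ge0 (b - t); rewrite sqrrB; lra.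
  rewrite (peak_prim_neg (ltW b0)).
  move: b0 xb; rewrite -(opprK b); move: (- b) => {b} u.
  rewrite oppr_lt0 ltrN2 opprK => u0 uy.
  have h1 := lp_tangent H u y; have h2 := lp_tangent H u 0; rewrite (lpG0 H) in h2.
  have h3 : y * G u <= u * G y by nra.
  have h4 : u * t ^+ 2 <= y * t ^+ 2 by rewrite ler_wpM2r ?sqr_ge0// ltW.
  by rewrite -(ler_pM2l y0); nra.
- apply: (@peak_max_approx (- y) (- y) t (- t)); rewrite ?lexx//; [lra|lra|].
  rewrite (peak_prim_pos (ltW t0)) peak_prim_neg; last by lra.
  by rewrite !opprK; lra.
Qed.

Lemma peak_max_zero : uncentered_maximal f 0 = 0%:E.
Proof.
apply: (maximal_eq peak_cont peak_is_derive).
- move=> a b a0 b0; rewrite (peak_prim_pos (ltW b0)) (peak_prim_neg (ltW a0)) mul0r.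
  have := @lpG_ge0 (- a); have := sqr_ge0 b; lra.
- move=> e e0; pose d := Num.min 1 e.
  have d0 : 0 < d by rewrite lt_min ltr01.
  have d1 : d <= 1 by rewrite ge_min lexx.
  have de : d <= e by rewrite ge_min lexx orbT.
  exists (- d), d; split; [lra|lra|].
  rewrite (peak_prim_pos (ltW d0)) peak_prim_neg ?opprK; last by lra.
  rewrite (lp_quad H)//; have := lp_ep_le1 H; nra.
Qed.

Lemma peak_maxE x : uncentered_maximal f x = (peak_max g G x)%:E.
Proof.
rewrite /peak_max; have [x0|x0|->] := ltgtP x 0.
- exact: peak_max_left.
- exact: peak_max_right.
- by rewrite peak_max_zero !oppr0 expr0n/= (lpG0 H) mulr0 addr0 sqrtr0 subr0.
Qed.

Lemma peak_local_maximum (x : R) : local_maximum f x <-> x = 0.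
Proof.
have f0 : f 0 = 0 by rewrite peak_pos ?oppr0.
split=> [lx|->]; last first.
  near=> y; rewrite f0; have [y0|y0] := leP 0 y.
    by rewrite peak_pos// oppr_le0.
  by rewrite (peak_neg (ltW y0)) oppr_le0 -(lp0 H) ltW// (lp_homo_lt H)// oppr_gt0.
apply/eqP/negPn/negP => x0; move: lx; rewrite /local_maximum.
have [xn lx|xp lx|xE] := ltgtP x 0; last by rewrite xE eqxx in x0.
- near x^'+ => y.
  have : f y <= f x by near: y; exact: cvg_within.
  have xy : x < y by [].
  have yn : y < 0 by near: y; exact: nbhs_right_lt.
  rewrite (peak_neg (ltW xn)) (peak_neg (ltW yn)) lerN2 leNgt (lp_homo_lt H)//.
  by rewrite ltrN2.
- near x^'- => y.
  have : f y <= f x by near: y; exact: cvg_within.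
  have xy : y < x by [].
  have yn : 0 < y by near: y; exact: nbhs_left_gt.
  by rewrite (peak_pos (ltW xp)) (peak_pos (ltW yn)) lerN2 leNgt xy.
Unshelve. all: by end_near. Qed.

End peak_theory.

(** * Weak derivatives and variation *)

Section weak_derivative.
Context {R : realType}.
Implicit Types (f g phi F : R -> R).
Notation mu := (@lebesgue_measure R).

Lemma C1_test_support phi : C1_compact_support phi ->
  exists2 M : R, 0 < M & forall x, M <= `|x| -> phi x = 0 /\ derive1 phi x = 0.
Proof.
move=> [dphi cphi /compact_bounded[M0 [_ hM0]]].
pose M1 := Num.max M0 0 + 1.
have M01 : M0 < M1 by rewrite /M1 ltr_pwDr// le_max lexx.
have M10 : 0 < M1 by rewrite /M1 ltr_wpDl// le_max lexx orbT.
exists (M1 + 1); first by rewrite addr_gt0.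
move=> x Mx.
have near0 : \forall y \near x, phi y = 0.
  have : open (~` closure [set y | phi y != 0]) by apply: closed_openC; exact: closed_closure.
  rewrite openE => /(_ x) H.
  have /H : (~` closure [set y | phi y != 0]) x.
    by move=> /(hM0 _ M01) /= xM; move: (le_trans Mx xM); rewrite gerDl ler10.
  rewrite /interior/=; apply: filterS => y /= ny.
  by apply/eqP/negPn/negP => py; apply: ny; exact: subset_closure.
split; first exact: nbhs_singleton near0.
rewrite derive1E (@near_eq_derive _ _ _ _ (cst 0)) ?derive_cst//.
Qed.

Lemma C1_test_cont phi : C1_compact_support phi -> continuous phi.
Proof.
move=> [dphi _ _] x; apply/differentiable_continuous/derivable1_diffP.
exact: dphi.
Qed.

Lemma Rintegral_support (h : R -> R) (D : set R) :
  (forall x, ~ D x -> h x = 0) ->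
  \int[mu]_x h x = \int[mu]_(x in D) h x.
Proof.
move=> h0; rewrite [RHS]Rintegral_mkcond; congr (Rintegral _ _ _).
apply/funext => x; rewrite patchE; case: ifPn => // /negP xD.
by rewrite h0// => Dx; apply: xD; rewrite inE.
Qed.

Lemma continuous_locally_integrable f : continuous f -> locally_integrable setT f.
Proof.
move=> cf; split; [exact: continuous_measurable_fun|exact: openT|].
move=> K _ cK.
have /integrableP[_] : mu.-integrable K (EFin \o f).
  by apply: continuous_compact_integrable => //; exact: continuous_subspaceT.
exact.
Qed.

Lemma integrable_mul_test f (psi : R -> R) (M : R) :
  locally_integrable setT f -> continuous psi ->
  (forall x, M <= `|x| -> psi x = 0) ->
  mu.-integrable setT (EFin \o (fun x => f x * psi x)).
Proof.
move=> [mf _ lf] cpsi psi0.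
have cI : compact (`[- M, M]%classic : set R) by exact: segment_compact.
have fI : mu.-integrable `[- M, M] (EFin \o f).
  apply/integrableP; split; last exact: lf.
  by apply/measurable_EFinP; apply: measurable_funS mf.
have pI : [bounded psi x | x in `[- M, M]%classic].
  have /compact_bounded : compact (psi @` `[- M, M]%classic).
    by apply: continuous_compact => //; exact: continuous_subspaceT.
  move=> [N [Nr hN]]; exists N; split => // y Ny x xI.
  by apply: hN => //; exists x.
have I1 : mu.-integrable `[- M, M] (fun x => (f x * psi x)%:E).
  apply: (integrableMl _ fI) => //.
  by apply: (measurable_funS (E := setT)) => //; exact: continuous_measurable_fun.
have : mu.-integrable setT ((fun x => (f x * psi x)%:E) \_ `[- M, M]).
  by apply/integrable_restrict => //; rewrite setTI.
congr (mu.-integrable _ _); apply/funext => x; rewrite patchE/=; case: ifPn => // /negP xI.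
rewrite psi0 ?mulr0// leNgt; apply/negP => xM; apply: xI.
by rewrite inE/= in_itv/= -ler_norml ltW.
Qed.

(** The test function need only vanish at the left endpoint: the boundary term at
[b] is what turns a step into a point evaluation. *)
Lemma by_parts_test F phi (a b : R) : a < b ->
  (forall x, derivable F x 1) -> continuous (derive1 F) ->
  C1_compact_support phi -> phi a = 0 ->
  \int[mu]_(x in `[a, b]) (F x * derive1 phi x) =
  F b * phi b - \int[mu]_(x in `[a, b]) (derive1 F x * phi x).
Proof.
move=> ab dF cF [dphi cphi sphi] pa.
have LR (G : R -> R) : (forall x, derivable G x 1) -> derivable_oo_LRcontinuous G a b.
  move=> dG; have Gc : continuous G.
    by move=> z; apply/differentiable_continuous/derivable1_diffP; exact: dG.
  split=> [z _||]; first exact: dG.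
  - by apply: cvg_at_right_filter; exact: Gc.
  - by apply: cvg_at_left_filter; exact: Gc.
have cFab : {within `[a, b], continuous (derive1 F)} := continuous_subspaceT cF.
have cphiab : {within `[a, b], continuous (derive1 phi)} := continuous_subspaceT cphi.
have LF : derivable_oo_LRcontinuous F a b by exact: LR.
have Lphi : derivable_oo_LRcontinuous phi a b by exact: LR.
have -> := @Rintegration_by_parts R F phi (derive1 F) (derive1 phi) a b ab
  cFab LF (fun _ _ => erefl) cphiab Lphi (fun _ _ => erefl).
by rewrite pa mulr0 subr0.
Qed.

Lemma C1_weak_derivative F : (forall x, derivable F x 1) ->
  continuous (derive1 F) -> is_weak_derivative F (derive1 F).
Proof.
move=> dF cF.
have Fc : continuous F.
  by move=> z; apply/differentiable_continuous/derivable1_diffP; exact: dF.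
split; [exact: continuous_locally_integrable..|].
move=> phi tphi; have [M M0 phi0] := C1_test_support tphi.
have out x : ~ `[- M, M]%classic x -> M <= `|x|.
  move=> /= h; rewrite leNgt; apply/negP => xM; apply: h.
  by rewrite in_itv/= -ler_norml ltW.
have nM : M <= `|- M| by rewrite normrN ler_norm.
rewrite (@Rintegral_support _ `[- M, M]); last first.
  by move=> x /out /phi0[_ ->]; rewrite mulr0.
rewrite (@Rintegral_support (fun x => derive1 F x * _) `[- M, M]); last first.
  by move=> x /out /phi0[-> _]; rewrite mulr0.
rewrite by_parts_test//; last by case: (phi0 _ nM).
  by case: (phi0 _ (ler_norm M)) => -> _; rewrite mulr0 sub0r.
by lra.
Qed.

Definition step (c x : R) : R := (x <= c)%R%:R.

Lemma step_indic c : step c = \1_(`]-oo, c]%classic).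
Proof.
apply/funext => x; rewrite /step indicE; congr (nat_of_bool _)%:R.
by apply/idP/idP; rewrite inE/= in_itv.
Qed.

Lemma step_locally_integrable c : locally_integrable setT (step c).
Proof.
rewrite step_indic; apply: locally_integrable_indic; first exact: openT.
exact: measurable_itv.
Qed.

Lemma Rintegral_step_test c (a b : R) (psi : R -> R) : a < c ->
  (forall x, x < a -> psi x = 0) ->
  \int[mu]_x (step c x * psi x) = \int[mu]_(x in `[a, c]) psi x.
Proof.
move=> ac psi0; rewrite (@Rintegral_support _ `[a, c]).
  apply: eq_Rintegral => x; rewrite inE/= in_itv/= => /andP[_ xc].
  by rewrite /step xc mul1r.
move=> x /= h; rewrite /step; have [xc|xc] := leP x c; last by rewrite mul0r.
rewrite psi0 ?mulr0//; rewrite ltNge; apply/negP => ax; apply: h.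
by rewrite in_itv/= ax.
Qed.

Lemma ramp_weak_derivative c :
  is_weak_derivative (fun x => ramp (c - x)) (fun x => - step c x).
Proof.
split.
- apply: continuous_locally_integrable => x.
  apply: (@continuous_comp _ _ _ (fun x => c - x) ramp); last exact: ramp_continuous.
  by apply: cvgB; [exact: cvg_cst|exact: cvg_id].
- exact/locally_integrableN/step_locally_integrable.
move=> phi tphi; have [M M0 phi0] := C1_test_support tphi.
pose a := Num.min (- M) (c - 1).
have ac : a < c by rewrite gt_min (_ : c - 1 < c) ?orbT// ltrBlDr ltrDl.
have aM : a <= - M by rewrite ge_min lexx.
have out x : x <= a -> M <= `|x|.
  move=> xa; have xM := le_trans xa aM.
  by rewrite ler0_norm; lra.
transitivity (\int[mu]_x (step c x * phi x)); last first.
  rewrite -(opprK (\int[mu]_x (step c x * phi x))); congr (- _).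
  rewrite -[LHS]mulN1r -RintegralZl//; last first.
    apply: (@integrable_mul_test _ _ M); [exact: step_locally_integrable|exact: C1_test_cont|].
    by move=> x /phi0[].
  by apply: eq_Rintegral => x _; rewrite mulN1r mulNr.
rewrite (@Rintegral_step_test c a c)//; last by move=> x /ltW /out /phi0[].
transitivity (\int[mu]_(x in `[a, c]) ((c - x) * derive1 phi x)).
  rewrite (@Rintegral_support _ `[a, c]).
    by apply: eq_Rintegral => x; rewrite inE/= in_itv/= => /andP[_ xc]; rewrite ramp_pos ?subr_ge0.
  move=> x /= h; have [xc|/ltW xc] := leP x c; last by rewrite ramp_neg ?mul0r// subr_le0.
  have /out/phi0[_ ->] : x <= a; last by rewrite mulr0.
  by rewrite leNgt; apply/negP => ax; apply: h; rewrite in_itv/= (ltW ax).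
have D (x : R) : is_derive x (1 : R) (fun x : R => c - x) (-1).
  by apply: is_derive_eq; ring.
have D1 : derive1 (fun x : R => c - x) = cst (-1).
  by apply/funext => x; rewrite derive1E; case: (D x).
rewrite by_parts_test// ?D1.
- rewrite subrr mul0r sub0r -[LHS]mulN1r -RintegralZl//.
    by apply: eq_Rintegral => x _ /=; rewrite !mulN1r opprK.
  apply: (@continuous_compact_integrable _ (fun x => -1 * phi x)); first exact: segment_compact.
  apply: continuous_subspaceT => x; apply: cvgM; [exact: cvg_cst|exact: C1_test_cont].
- by move=> x; exact: cst_continuous.
- by case: (phi0 _ (out _ (lexx a))).
Qed.

Lemma is_weak_derivativeD f1 f2 g1 g2 :
  is_weak_derivative f1 g1 -> is_weak_derivative f2 g2 ->
  is_weak_derivative (fun x => f1 x + f2 x) (fun x => g1 x + g2 x).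
Proof.
move=> [lf1 lg1 h1] [lf2 lg2 h2]; split; [exact: locally_integrableD..|].
move=> phi tphi; have [M M0 phi0] := C1_test_support tphi.
have cphi := C1_test_cont tphi; have cphi' : continuous (derive1 phi) by case: tphi.
have p0 x : M <= `|x| -> phi x = 0 by case/phi0.
have dp0 x : M <= `|x| -> derive1 phi x = 0 by case/phi0.
transitivity (\int[mu]_x (f1 x * derive1 phi x + f2 x * derive1 phi x)).
  by apply: eq_Rintegral => x _; rewrite mulrDl.
rewrite RintegralD//; [|exact: integrable_mul_test dp0..].
rewrite h1// h2// -opprD -RintegralD//; [|exact: integrable_mul_test p0..].
by congr (- _); apply: eq_Rintegral => x _; rewrite mulrDl.
Qed.

Lemma locally_integrableZ f (k : R) : locally_integrable setT f ->
  locally_integrable setT (fun x => k * f x).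
Proof.
move=> [mf oT lf]; split=> //; first exact: measurable_funM.
move=> K KT cK; have := lf _ KT cK => fK.
have fK' : mu.-integrable K (EFin \o f).
  apply/integrableP; split=> //; apply/measurable_EFinP.
  by apply: measurable_funS mf => //; exact: compact_measurable.
suff /integrableP[] : mu.-integrable K (fun x => k%:E * (f x)%:E)%E by [].
by apply: integrableZl => //; exact: compact_measurable.
Qed.

Lemma is_weak_derivativeZ (k : R) f g : is_weak_derivative f g ->
  is_weak_derivative (fun x => k * f x) (fun x => k * g x).
Proof.
move=> [lf lg h]; split; [exact: locally_integrableZ..|].
move=> phi tphi; have [M M0 phi0] := C1_test_support tphi.
have cphi := C1_test_cont tphi; have cphi' : continuous (derive1 phi) by case: tphi.
have p0 x : M <= `|x| -> phi x = 0 by case/phi0.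
have dp0 x : M <= `|x| -> derive1 phi x = 0 by case/phi0.
transitivity (\int[mu]_x (k * (f x * derive1 phi x))).
  by apply: eq_Rintegral => x _; rewrite mulrA.
rewrite RintegralZl//; last exact: integrable_mul_test dp0.
rewrite h// mulrN -RintegralZl//; last exact: integrable_mul_test p0.
by congr (- _); apply: eq_Rintegral => x _; rewrite mulrA.
Qed.

Lemma is_weak_derivative_cst (k : R) : is_weak_derivative (cst k) (cst 0).
Proof.
have D (x : R) : is_derive x (1 : R) (cst k) 0 by exact: is_derive_cst.
have E : derive1 (cst k) = cst (0 : R).
  by apply/funext => x; rewrite derive1E; case: (D x).
rewrite -E; apply: C1_weak_derivative; first by move=> x; case: (D x).
by rewrite E; move=> x; exact: cst_continuous.
Qed.

Lemma is_weak_derivative_sum K (f g : nat -> R -> R) :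
  (forall k, (k < K)%N -> is_weak_derivative (f k) (g k)) ->
  is_weak_derivative (fun x => \sum_(k < K) f k x) (fun x => \sum_(k < K) g k x).
Proof.
elim: K => [|K IH] h.
  have := is_weak_derivative_cst 0; congr is_weak_derivative;
    by apply/funext => x; rewrite big_ord0.
have := is_weak_derivativeD (IH (fun k kK => h k (ltnW kK))) (h K (ltnSn K)).
by congr is_weak_derivative; apply/funext => x; rewrite big_ord_recr.
Qed.

(** Local integrability is part of the predicate so that it is stable under linear
combinations, which have to be integrated termwise. *)
Definition var_le g (V : R) := locally_integrable setT g /\
  forall phi, C1_compact_support phi -> (forall x, `|phi x| <= 1) ->
  `|\int[mu]_x (g x * derive1 phi x)| <= V.

Lemma var_le_var g V : var_le g V -> (var g <= V%:E)%E.
Proof.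
move=> [_ h]; apply: ge_ereal_sup => _ [phi [tphi p1 ->]].
rewrite lee_fin; apply: le_trans (h _ tphi p1).
by rewrite -normrN ler_norm.
Qed.

Lemma var_leD g1 g2 V1 V2 : var_le g1 V1 -> var_le g2 V2 ->
  var_le (fun x => g1 x + g2 x) (V1 + V2).
Proof.
move=> [l1 h1] [l2 h2]; split; first exact: locally_integrableD.
move=> phi tphi p1; have [M M0 phi0] := C1_test_support tphi.
have cphi' : continuous (derive1 phi) by case: tphi.
have dp0 x : M <= `|x| -> derive1 phi x = 0 by case/phi0.
rewrite (_ : \int[mu]_x _ = \int[mu]_x (g1 x * derive1 phi x + g2 x * derive1 phi x)).
  rewrite RintegralD//; [|exact: integrable_mul_test dp0..].
  by rewrite (le_trans (ler_normD _ _))// lerD ?h1 ?h2.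
by apply: eq_Rintegral => x _; rewrite mulrDl.
Qed.

Lemma var_leZ (k : R) g V : var_le g V -> var_le (fun x => k * g x) (`|k| * V).
Proof.
move=> [l h]; split; first exact: locally_integrableZ.
move=> phi tphi p1; have [M M0 phi0] := C1_test_support tphi.
have cphi' : continuous (derive1 phi) by case: tphi.
have dp0 x : M <= `|x| -> derive1 phi x = 0 by case/phi0.
rewrite (_ : \int[mu]_x _ = \int[mu]_x (k * (g x * derive1 phi x))).
  rewrite RintegralZl//; last exact: integrable_mul_test dp0.
  by rewrite normrM ler_wpM2l// h.
by apply: eq_Rintegral => x _; rewrite mulrA.
Qed.

Lemma var_le_cst (k : R) : var_le (cst k) 0.
Proof.
have [lk _ h] := is_weak_derivative_cst k; split=> // phi tphi _.
rewrite h//; under eq_Rintegral do rewrite mul0r.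
by rewrite Rintegral_cst// mul0r oppr0 normr0.
Qed.

Lemma var_le_step c : var_le (step c) 1.
Proof.
split; first exact: step_locally_integrable.
move=> phi tphi p1; have [M M0 phi0] := C1_test_support tphi.
pose a := Num.min (- M) (c - 1).
have ac : a < c by rewrite gt_min (_ : c - 1 < c) ?orbT// ltrBlDr ltrDl.
have aM : a <= - M by rewrite ge_min lexx.
have out x : x <= a -> M <= `|x|.
  move=> xa; have xM := le_trans xa aM.
  by rewrite ler0_norm; lra.
rewrite (@Rintegral_step_test c a c)//; last by move=> x /ltW /out /phi0[].
rewrite (_ : \int[mu]_(x in _) _ = \int[mu]_(x in `[a, c]) (@cst R R 1 x * derive1 phi x)); last first.
  by apply: eq_Rintegral => x _; rewrite mul1r.
have D1 : derive1 (@cst R R 1) = cst 0 by apply/funext => x; rewrite derive1E derive_cst.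
rewrite by_parts_test//.
- rewrite D1; under eq_Rintegral do rewrite mul0r.
  by rewrite Rintegral_cst// mul0r subr0 mul1r.
- by rewrite D1 => x; exact: cst_continuous.
- by case: (phi0 _ (out _ (lexx a))).
Qed.

Lemma var_le_sum K (g : nat -> R -> R) (V : nat -> R) :
  (forall k, (k < K)%N -> var_le (g k) (V k)) ->
  var_le (fun x => \sum_(k < K) g k x) (\sum_(k < K) V k).
Proof.
elim: K => [|K IH] h.
  rewrite big_ord0; have := var_le_cst 0; congr var_le.
  by apply/funext => x; rewrite big_ord0.
have := var_leD (IH (fun k kK => h k (ltnW kK))) (h K (ltnSn K)).
by rewrite big_ord_recr; congr var_le; apply/funext => x; rewrite big_ord_recr.
Qed.

End weak_derivative.

(** * The derivative of the maximal function *)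

Lemma C1_of_local {R : realType} (F : R -> R) :
  (forall x : R, exists D : R -> R, {for x, continuous D} /\
     \forall y \near x, is_derive y (1 : R) F (D y)) ->
  (forall x, derivable F x 1) /\ continuous (derive1 F).
Proof.
move=> h; split=> x; have [D [cD FD]] := h x.
  by case: (nbhs_singleton FD).
rewrite /continuous_at (_ : derive1 F x = D x); last first.
  by rewrite derive1E; case: (nbhs_singleton FD).
apply: cvg_trans cD; apply: near_eq_cvg.
by apply: filterS FD => y [_ <-]; rewrite derive1E.
Qed.

Section peak_max_derivative_defs.
Context {R : realType}.
Implicit Types (g G : R -> R) (ep x : R).

Definition depth_slope g G x : R := (x - depth g G x) / (x + foot g G x).

Definition left_slope g G x : R :=
  - 1 - (x - g (- x)) / Num.sqrt (x ^+ 2 + 2 * G (- x)).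

(** The positive root [k] of [ep * (k ^+ 2 + 2 * k) = 1]: near [0], where the peak is
piecewise linear, [foot x = foot_ratio ep * x] by homogeneity. *)
Definition foot_ratio ep : R := Num.sqrt (1 + ep^-1) - 1.

(** The one-sided slopes of the maximal function at [0] are [Num.sqrt (1 + ep) - 1] on
the left and [- ep * foot_ratio ep] on the right; [kink ep] times a ramp accounts
for their difference. *)
Definition kink ep : R := 1 - Num.sqrt (1 + ep) - ep * foot_ratio ep.

Definition peak_max_smooth g G ep x : R := peak_max g G x - kink ep * ramp (0 - x).

Definition peak_max_deriv g G ep x : R :=
  derive1 (peak_max_smooth g G ep) x + kink ep * - step 0 x.

End peak_max_derivative_defs.

Section peak_max_derivative.
Context {R : realType} {g G : R -> R} {m ep : R}.
Hypothesis H : left_profile g G m ep.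

Let m_gt0 : 0 < m := lp_m_gt0 H.
Let ep_gt0 : 0 < ep := lp_ep_gt0 H.

Local Notation foot := (foot g G).
Local Notation depth := (depth g G).
Local Notation F := (peak_max g G).
Local Notation slope := (depth_slope g G).
Local Notation F2 := (peak_max_smooth g G ep).

Lemma depth_slope_cont (x : R) : 0 < x -> {for x, continuous slope}.
Proof.
move=> x0; apply: cvgM.
  by apply: cvgB; [exact: cvg_id|exact: depth_cont H _ _].
apply: cvgV; first by rewrite gt_eqF// addr_gt0// (foot_gt0 H).
by apply: cvgD; [exact: cvg_id|exact: foot_cont H _ _].
Qed.

Lemma peak_max_is_derive_right (x : R) : 0 < x ->
  is_derive x (1 : R) F (- slope x).
Proof.
move=> x0; apply: (@near_eq_is_derive _ R R (- depth)).
  near=> y; rewrite /peak_max ifF//; apply/negbTE; rewrite -ltNge.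
  by near: y; exact: lt_nbhsr.
exact/is_deriveN/(depth_is_derive H).
Unshelve. all: by end_near. Qed.

Lemma left_radicand_gt0 (x : R) : x < 0 -> 0 < x ^+ 2 + 2 * G (- x).
Proof.
move=> x0; have := lpG_gt0 H (_ : 0 < - x); rewrite oppr_gt0 => /(_ x0) G0.
by apply: addr_gt0; [rewrite exprn_even_gt0//= lt_eqF|exact: mulr_gt0].
Qed.

Lemma left_slope_cont (x : R) : x < 0 -> {for x, continuous (left_slope g G)}.
Proof.
move=> x0; apply: cvgB; first exact: cvg_cst.
have cg : (g \o -%R) @ x --> g (- x).
  by apply: continuous_comp; [exact: opp_continuous|exact: lp_cont H _].
have cG : (G \o -%R) @ x --> G (- x).
  by apply: continuous_comp; [exact: opp_continuous|exact: lpG_cont H _].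
have cr : (fun y : R => y ^+ 2 + 2 * G (- y)) @ x --> x ^+ 2 + 2 * G (- x).
  apply: cvgD; last by apply: cvgM; [exact: cvg_cst|exact: cG].
  exact: exprn_continuous.
apply: cvgM; first by apply: cvgB; [exact: cvg_id|exact: cg].
apply: cvgV; first by rewrite gt_eqF// sqrtr_gt0 left_radicand_gt0.
exact: (cvg_comp _ _ cr (@sqrt_continuous _ _)).
Qed.

Lemma peak_max_is_derive_left (x : R) : x < 0 ->
  is_derive x (1 : R) F (left_slope g G x).
Proof.
move=> x0.
apply: (@near_eq_is_derive _ R R (fun x => - x - Num.sqrt (x ^+ 2 + 2 * G (- x)))).
  by near=> y; rewrite /peak_max ifT//; apply/ltW; near: y; exact: lt_nbhsl.
have d1 : is_derive x (1 : R) (G \o -%R) (g (- x) * (- 1)).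
  by apply: is_derive1_comp; exact: lp_deriv H _.
have d2 : is_derive x (1 : R) (fun y : R => y ^+ 2) (2 * x).
  by apply: is_derive_eq; rewrite /GRing.scale/=; ring.
have d3 := is_deriveD d2 (is_deriveZ 2 d1).
have d4 := is_derive1_sqrt (left_radicand_gt0 x0).
have d5 := @is_derive1_comp _ Num.sqrt _ x _ _ d4 d3.
have d6 := is_deriveB (is_deriveNid x (1 : R)) d5.
apply: (is_derive_eq d6); rewrite /left_slope /GRing.scale/=.
by field; rewrite gt_eqF// sqrtr_gt0 left_radicand_gt0.
Unshelve. all: by end_near. Qed.

Let kappa := foot_ratio ep.

Let kappa_gt0 : 0 < kappa.
Proof.
rewrite /kappa /foot_ratio subr_gt0 -[ltLHS]sqrtr1 ltr_sqrt ?ltrDl ?invr_gt0//.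
by rewrite addr_gt0 ?invr_gt0.
Qed.

Let kappaE : ep * (kappa ^+ 2 + 2 * kappa) = 1.
Proof.
have : Num.sqrt (1 + ep^-1) ^+ 2 = 1 + ep^-1.
  by rewrite sqr_sqrtr// addr_ge0// invr_ge0 ltW.
rewrite /kappa /foot_ratio; set S := Num.sqrt _ => SE.
rewrite (_ : _ + _ = S ^+ 2 - 1); last by ring.
by rewrite SE addrAC subrr add0r mulfV// gt_eqF.
Qed.

Lemma depth_near0 (x : R) : 0 < x -> kappa * x <= 1 -> depth x = ep * kappa * x.
Proof.
move=> x0 kx1; have kx0 : 0 < kappa * x by rewrite mulr_gt0.
rewrite /depth (foot_unique H x0 (ltW kx0)).
  by rewrite (lp_lin H)// mulrA.
rewrite /foot_eq (lp_lin H)// (lp_quad H)//.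
have : x ^+ 2 * (ep * (kappa ^+ 2 + 2 * kappa)) = x ^+ 2 by rewrite kappaE mulr1.
lra.
Qed.

Let F2_near0 : \forall x \near (0 : R), F2 x = - (ep * kappa) * x.
Proof.
near=> x.
have xk : kappa * x <= 1.
  rewrite mulrC -ler_pdivlMr// mul1r ltW//; near: x; apply: lt_nbhsl.
  by rewrite invr_gt0.
have x1 : - 1 <= x by rewrite ltW//; near: x; apply: lt_nbhsr; rewrite oppr_lt0.
rewrite /peak_max_smooth /peak_max; have [x0|x0] := leP x 0; last first.
  by rewrite ramp_neg ?sub0r ?oppr_le0 ?(ltW x0)// depth_near0//; ring.
rewrite ramp_pos ?sub0r ?oppr_ge0//.
rewrite (lp_quad H); last by lra.
rewrite (_ : _ + _ = (1 + ep) * (- x) ^+ 2); last by field.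
rewrite sqrtrM; last by rewrite addr_ge0// ltW.
by rewrite sqrtr_sqr ger0_norm ?oppr_ge0// /kink -/kappa; ring.
Unshelve. all: by end_near. Qed.

Let F2_C1 : (forall x, derivable F2 x 1) /\ continuous (derive1 F2).
Proof.
apply: C1_of_local => x; have [x0|x0|->] := ltgtP x 0.
- exists (fun y => left_slope g G y + kink ep); split.
    by apply: cvgD; [exact: left_slope_cont|exact: cvg_cst].
  near=> y; have y0 : y < 0 by near: y; exact: lt_nbhsl.
  apply: (@near_eq_is_derive _ R R (fun z => F z + kink ep * z)).
    near=> z; rewrite /peak_max_smooth ramp_pos ?sub0r ?mulrN ?opprK// oppr_ge0 ltW//.
    by near: z; exact: lt_nbhsl.
  have d1 := peak_max_is_derive_left y0.
  have d2 := is_deriveD d1 (is_deriveZ (kink ep) (is_derive_id y (1 : R))).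
  by apply: (is_derive_eq d2); rewrite /GRing.scale/= mulr1.
- exists (fun y => - slope y); split.
    by apply: cvgN; exact: depth_slope_cont.
  near=> y; have y0 : 0 < y by near: y; exact: lt_nbhsr.
  apply: (@near_eq_is_derive _ R R F).
    near=> z; rewrite /peak_max_smooth ramp_neg ?mulr0 ?subr0// sub0r oppr_le0 ltW//.
    by near: z; exact: lt_nbhsr.
  exact: peak_max_is_derive_right.
- exists (cst (- (ep * kappa))); split; first exact: cvg_cst.
  have := near_join F2_near0; apply: filterS => y hy.
  apply: (@near_eq_is_derive _ R R (fun z => - (ep * kappa) * z)).
    by apply: filterS hy => z ->.
  have d := is_deriveZ (- (ep * kappa)) (is_derive_id y (1 : R)).
  by apply: (is_derive_eq d); rewrite /GRing.scale/= mulr1.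
Unshelve. all: by end_near. Qed.

Lemma peak_max_weak_derivative : is_weak_derivative F (peak_max_deriv g G ep).
Proof.
have [d c] := F2_C1.
have := is_weak_derivativeD (C1_weak_derivative d c)
  (is_weak_derivativeZ (kink ep) (ramp_weak_derivative 0)).
by congr is_weak_derivative; apply/funext => x; rewrite /peak_max_smooth subrK.
Qed.

Lemma peak_max_derivE (x : R) : 0 < x -> peak_max_deriv g G ep x = - slope x.
Proof.
move=> x0; rewrite /peak_max_deriv /step leNgt x0 oppr0 mulr0 addr0.
rewrite derive1E (@near_eq_derive _ _ _ _ F).
  by have [_] := peak_max_is_derive_right x0.
near=> z; rewrite /peak_max_smooth ramp_neg ?mulr0 ?subr0// sub0r oppr_le0 ltW//.
by near: z; exact: lt_nbhsr.
Unshelve. all: by end_near. Qed.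

End peak_max_derivative.

(** * The staircase profile *)

Section clamp.
Context {R : realType}.
Implicit Types a b c s u v : R.

Definition clamp a b s : R := ramp (s - a) - ramp (s - b).

Lemma clamp_below a b s : a <= b -> s <= a -> clamp a b s = 0.
Proof. by move=> ab sa; rewrite /clamp !ramp_neg ?subrr//; lra. Qed.

Lemma clamp_in a b s : a <= s -> s <= b -> clamp a b s = s - a.
Proof.
by move=> sa sb; rewrite /clamp ramp_pos ?ramp_neg ?subr0// ?subr_ge0// subr_le0.
Qed.

Lemma clamp_above a b s : a <= b -> b <= s -> clamp a b s = b - a.
Proof. by move=> ab bs; rewrite /clamp !ramp_pos; lra. Qed.

Lemma clampD a b c s : clamp a b s + clamp b c s = clamp a c s.
Proof. by rewrite /clamp; ring. Qed.

Lemma clamp_homo a b u v : a <= b -> u <= v -> clamp a b u <= clamp a b v.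
Proof.
move=> ab uv; rewrite /clamp /ramp.
by case: (lerP (u - a) 0) => ?; case: (lerP (u - b) 0) => ?;
  case: (lerP (v - a) 0) => ?; case: (lerP (v - b) 0) => ?; lra.
Qed.

Lemma clamp_lip a b u v : a <= b -> u <= v -> clamp a b v - clamp a b u <= v - u.
Proof.
move=> ab uv; rewrite /clamp /ramp.
by case: (lerP (u - a) 0) => ?; case: (lerP (u - b) 0) => ?;
  case: (lerP (v - a) 0) => ?; case: (lerP (v - b) 0) => ?; lra.
Qed.

End clamp.

Lemma is_derive_bigsum {R : realType} K (f f' : nat -> R -> R) (x : R) :
  (forall k, is_derive x (1 : R) (f k) (f' k x)) ->
  is_derive x (1 : R) (fun y => \sum_(k < K) f k y) (\sum_(k < K) f' k x).
Proof.
move=> h; elim: K => [|K IH].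
  rewrite big_ord0 (_ : (fun y => _) = cst 0); first exact: is_derive_cst.
  by apply/funext => y; rewrite big_ord0.
rewrite big_ord_recr (_ : (fun y => _) = (fun y => \sum_(k < K) f k y) + f K).
  exact: is_deriveD.
by apply/funext => y; rewrite big_ord_recr.
Qed.

Section staircase.
Context {R : realType}.
Variables (K : nat) (e : R).

(** The height gained by the profile along any of its treads. The factor [200] makes it
small enough, compared with [e ^+ 2], for the estimates on a tread. *)
Definition rise : R := e ^+ 2 / 200.

Definition tread_slope (k : nat) : R := rise / 4 ^+ k.

Definition stair (s : R) : R :=
  e ^+ 2 * s - \sum_(k < K) (e ^+ 2 - tread_slope k) * clamp (4 ^+ k) (2 * 4 ^+ k) s.

Definition stair_prim (s : R) : R :=
  e ^+ 2 * s ^+ 2 / 2 - \sum_(k < K) (e ^+ 2 - tread_slope k) *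
     (ramp (s - 4 ^+ k) ^+ 2 / 2 - ramp (s - 2 * 4 ^+ k) ^+ 2 / 2).

Hypotheses (e_gt0 : 0 < e) (e_le : e <= 1 / 2).

Lemma rise_gt0 : 0 < rise.
Proof. by apply: divr_gt0; rewrite ?ltr0n ?exprn_gt0. Qed.

Lemma scale_ge1 k : 1 <= 4 ^+ k :> R.
Proof. by rewrite exprn_ege1// ler1n. Qed.

Let scale_gt0 k : 0 < 4 ^+ k :> R.
Proof. by rewrite exprn_gt0. Qed.

Let scale_le k : 4 ^+ k <= 2 * 4 ^+ k :> R.
Proof. by have := scale_gt0 k; lra. Qed.

Lemma tread_slope_gt0 k : 0 < tread_slope k.
Proof. by rewrite divr_gt0// rise_gt0. Qed.

Lemma tread_slopeE k : tread_slope k * 4 ^+ k = rise.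
Proof. by rewrite /tread_slope divfK// gt_eqF. Qed.

Lemma tread_slope_le k : tread_slope k <= e ^+ 2.
Proof.
have h : rise <= e ^+ 2 by rewrite /rise; have := exprn_gt0 2 e_gt0; lra.
apply: le_trans h; rewrite ler_pdivrMr//.
by rewrite ler_peMr ?scale_ge1// ltW// rise_gt0.
Qed.

Lemma tread_slope_anti k : (k <= K)%N -> tread_slope K <= tread_slope k.
Proof.
move=> kK; rewrite /tread_slope ler_pM2l ?rise_gt0// lef_pV2 ?posrE//.
by rewrite ler_weXn2l// ler1n.
Qed.

Lemma stair_diff (u v : R) : stair v - stair u = e ^+ 2 * (v - u) -
  \sum_(k < K) (e ^+ 2 - tread_slope k) *
     (clamp (4 ^+ k) (2 * 4 ^+ k) v - clamp (4 ^+ k) (2 * 4 ^+ k) u).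
Proof.
under eq_bigr do rewrite mulrBr; rewrite sumrB /stair.
by rewrite mulrBr; ring.
Qed.

(** The treads are disjoint: completing each [4 ^ n, 2 * 4 ^ n] to [4 ^ n, 4 ^ n.+1]
makes the sum telescope. *)
Lemma sum_clamp_lip (u v : R) : u <= v ->
  \sum_(k < K) (clamp (4 ^+ k) (2 * 4 ^+ k) v - clamp (4 ^+ k) (2 * 4 ^+ k) u)
  <= v - u.
Proof.
move=> uv.
apply: (@le_trans _ _ (clamp 1 (4 ^+ K) v - clamp 1 (4 ^+ K) u)); last first.
  by rewrite clamp_lip// scale_ge1.
elim: K => [|n IH]; first by rewrite big_ord0 expr0 /clamp !subrr.
rewrite big_ord_recr/= -!(clampD 1 (4 ^+ n) (4 ^+ n.+1)).
rewrite -!(clampD (4 ^+ n) (2 * 4 ^+ n) (4 ^+ n.+1)).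
have := @clamp_homo _ (2 * 4 ^+ n) (4 ^+ n.+1) u v.
have h : 2 * 4 ^+ n <= 4 ^+ n.+1 :> R by have := scale_gt0 n; rewrite exprS; lra.
by move=> /(_ h uv); lra.
Qed.

Lemma stair_below (s : R) : s <= 1 -> stair s = e ^+ 2 * s.
Proof.
move=> s1; rewrite /stair big1 ?subr0// => k _.
by rewrite clamp_below ?mulr0// (le_trans s1)// scale_ge1.
Qed.

Lemma stair_prim_below (s : R) : s <= 1 -> stair_prim s = e ^+ 2 * s ^+ 2 / 2.
Proof.
move=> s1; rewrite /stair_prim big1 ?subr0// => k _.
have sk : s <= 4 ^+ k := le_trans s1 (scale_ge1 k).
by rewrite !ramp_neg ?subr_le0// ?(le_trans sk)// expr0n/= mul0r subrr mulr0.
Qed.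

Lemma stair_prim_is_derive (s : R) : is_derive s (1 : R) stair_prim (stair s).
Proof.
have dr (a : R) : is_derive s (1 : R) (fun y => ramp (y - a) ^+ 2 / 2) (ramp (s - a)).
  have d1 : is_derive s (1 : R) (fun y : R => y - a) 1.
    by apply: is_derive_eq; ring.
  have := @is_derive1_comp _ (fun y : R => ramp y ^+ 2 / 2) _ s _ _ (is_derive_ramp_sqr _) d1.
  by rewrite mulr1.
have d2 : is_derive s (1 : R) (fun y : R => e ^+ 2 * y ^+ 2 / 2) (e ^+ 2 * s).
  by apply: is_derive_eq; rewrite /GRing.scale/=; field.
have d3 := @is_derive_bigsum R K
  (fun k y => (e ^+ 2 - tread_slope k) *
     (ramp (y - 4 ^+ k) ^+ 2 / 2 - ramp (y - 2 * 4 ^+ k) ^+ 2 / 2))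
  (fun k y => (e ^+ 2 - tread_slope k) * clamp (4 ^+ k) (2 * 4 ^+ k) y) s
  (fun k => is_deriveZ (e ^+ 2 - tread_slope k) (is_deriveB (dr _) (dr _))).
exact: is_deriveB d2 d3.
Qed.

Lemma stair_profile : left_profile stair stair_prim (tread_slope K) (e ^+ 2).
Proof.
have e2 : 0 < e ^+ 2 by rewrite exprn_gt0.
split.
- exact: tread_slope_gt0.
- by rewrite expr_le1//; [move: e_le; lra|exact: ltW].
- exact: stair_prim_is_derive.
- move=> u v uv; rewrite stair_diff.
  have : \sum_(k < K) (e ^+ 2 - tread_slope k) *
     (clamp (4 ^+ k) (2 * 4 ^+ k) v - clamp (4 ^+ k) (2 * 4 ^+ k) u) <=
     (e ^+ 2 - tread_slope K) * (v - u).
    apply: le_trans (_ : (e ^+ 2 - tread_slope K) * \sum_(k < K)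
       (clamp (4 ^+ k) (2 * 4 ^+ k) v - clamp (4 ^+ k) (2 * 4 ^+ k) u) <= _).
      rewrite mulr_sumr; apply: ler_sum => k _; apply: ler_wpM2r.
        by rewrite subr_ge0 clamp_homo.
      by rewrite lerD2l lerN2 tread_slope_anti// ltnW.
    by rewrite ler_wpM2l ?sum_clamp_lip// subr_ge0 tread_slope_le.
  by lra.
- move=> u v uv; rewrite stair_diff gerBl sumr_ge0// => k _.
  by rewrite mulr_ge0// subr_ge0 ?tread_slope_le// clamp_homo.
- exact: stair_below.
- exact: stair_prim_below.
Qed.

Lemma scale_lt j k : (j < k)%N -> 4 * 4 ^+ j <= 4 ^+ k :> R.
Proof. by move=> jk; rewrite -exprS ler_weXn2l// ler1n. Qed.

Lemma stair_tread k (u v : R) : (k < K)%N ->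
  4 ^+ k <= u -> u <= v -> v <= 2 * 4 ^+ k ->
  stair v - stair u = tread_slope k * (v - u).
Proof.
move=> kK ku uv vk; rewrite stair_diff (bigD1 (Ordinal kK))//= big1 => [|j jk].
  by rewrite !clamp_in ?(le_trans ku uv)// ?(le_trans uv vk)//; ring.
have {}jk : (j != k :> nat)%N by apply: contra jk => /eqP jk; apply/eqP/val_inj.
have sj := scale_gt0 j; have sk := scale_gt0 k.
case: (ltngtP j k) jk => // jk _.
  by have := scale_lt jk => h; rewrite !clamp_above ?subrr ?mulr0//; lra.
by have := scale_lt jk => h; rewrite !clamp_below ?subrr ?mulr0//; lra.
Qed.

Lemma stair_riser k (u v : R) :
  4 ^+ k / 2 <= u -> u <= v -> v <= 4 ^+ k ->
  stair v - stair u = e ^+ 2 * (v - u).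
Proof.
move=> ku uv vk; rewrite stair_diff big1 ?subr0// => j _.
have sj := scale_gt0 j; have sk := scale_gt0 k.
case: (ltnP j k) => jk.
  by have := scale_lt jk => h; rewrite !clamp_above ?subrr ?mulr0//; lra.
have h : 4 ^+ k <= 4 ^+ j :> R by rewrite ler_weXn2l// ler1n.
by rewrite !clamp_below ?subrr ?mulr0//; lra.
Qed.

End staircase.

(** * Passing a tread *)

(** The point [x] whose optimal interval is [-s, x]: the root of the quadratic equation
[foot_eq g G x s] in [x] that exceeds [g s]. *)
Definition foot_inv {R : realType} (g G : R -> R) (s : R) : R :=
  g s + Num.sqrt (g s ^+ 2 + 2 * (s * g s - G s)).

Section foot_inv.
Context {R : realType} {g G : R -> R} {m ep : R}.
Hypothesis H : left_profile g G m ep.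

Let m_gt0 : 0 < m := lp_m_gt0 H.

Local Notation foot := (foot g G).
Local Notation depth := (depth g G).
Local Notation X := (foot_inv g G).

(** [s * g s - G s] is the value at [g s] of the Legendre transform of [G]. *)
Lemma legendre_ge0 s : 0 <= s * g s - G s.
Proof. by have := lp_tangent H s 0; rewrite (lpG0 H); lra. Qed.

Lemma foot_inv_gt0 s : 0 < s -> 0 < X s.
Proof.
move=> s0; rewrite /foot_inv ltr_pwDl ?sqrtr_ge0//.
by rewrite -(lp0 H) (lp_homo_lt H).
Qed.

Lemma foot_invK s : 0 < s -> foot (X s) = s.
Proof.
move=> s0; apply: (foot_unique H (foot_inv_gt0 s0) (ltW s0)).
rewrite /foot_eq /foot_inv; set S := Num.sqrt _.
have : S ^+ 2 = g s ^+ 2 + 2 * (s * g s - G s).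
  by rewrite sqr_sqrtr// addr_ge0 ?sqr_ge0// mulr_ge0// legendre_ge0.
by nra.
Qed.

Lemma foot_inv_incr s s' : 0 < s -> s < s' -> X s < X s'.
Proof.
move=> s0 ss; have s0' := lt_trans s0 ss.
case: (ltgtP (X s) (X s')) => // [h|h].
  have := foot_incr H (foot_inv_gt0 s0') h.
  by rewrite !foot_invK// => /(lt_trans ss); rewrite ltxx.
by move: (congr1 foot h); rewrite !foot_invK// => ss'; rewrite ss' ltxx in ss.
Qed.

Lemma depth_foot_inv s : 0 < s -> depth (X s) = g s.
Proof. by move=> s0; rewrite /depth foot_invK. Qed.

(** Completing the square in [foot_eq]: the numerator [x - depth x] of the slope of the
maximal function depends on the profile only through [depth] and the Legendre
transform. *)
Lemma gap_sqr x : 0 < x -> (x - depth x) ^+ 2 =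
  depth x ^+ 2 + 2 * (foot x * depth x - G (foot x)).
Proof.
by move=> x0; have [_] := footP H x0; rewrite /foot_eq -/(depth x); lra.
Qed.

Lemma gap_gt0 x : 0 < x -> 0 < x - depth x.
Proof. by move=> x0; have := depth_le H x0; have := depth_gt0 H x0; lra. Qed.

Lemma legendre_homo u v : u <= v ->
  u * (g v - g u) <= (v * g v - G v) - (u * g u - G u) <= v * (g v - g u).
Proof.
move=> uv; have := lp_tangent H u v; have := lp_tangent H v u.
by move=> h1 h2; apply/andP; split; lra.
Qed.

End foot_inv.

(** The derivative of [- depth_slope] where [foot] is an affine function of [depth] with
slope [1 / eta], that is, on a tread of slope [eta]. *)
Definition second_slope {R : realType} (g G : R -> R) (eta x : R) : R :=
  let q := depth_slope g G x in
  ((x - depth g G x) * (1 + q / eta) - (1 - q) * (x + foot g G x)) /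
  (x + foot g G x) ^+ 2.

Section tread.
Context {R : realType} {g G : R -> R} {m e : R}.
Hypothesis H : left_profile g G m (e ^+ 2).
Variables (sg eta : R).
Hypotheses (e_gt0 : 0 < e) (e_le : e <= 1 / 2) (sg_ge1 : 1 <= sg).
Hypothesis etaE : eta * sg = rise e.
Hypothesis riserE : g sg - g (sg / 2) = e ^+ 2 * (sg - sg / 2).
Hypothesis treadE : forall u v, sg <= u -> u <= v -> v <= 2 * sg ->
  g v - g u = eta * (v - u).

Local Notation foot := (foot g G).
Local Notation depth := (depth g G).
Local Notation x1 := (foot_inv g G sg).
Local Notation x2 := (foot_inv g G (2 * sg)).

Let sg_gt0 : 0 < sg := lt_le_trans ltr01 sg_ge1.
Let e2_gt0 : 0 < e ^+ 2. Proof. by rewrite exprn_gt0. Qed.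
Let e2_le : e ^+ 2 <= 1 / 4.
Proof.
have -> : 1 / 4 = (1 / 2) ^+ 2 :> R by field.
by rewrite lerXn2r ?nnegrE ?divr_ge0// ltW.
Qed.

Local Ltac lra_scale := move: sg_gt0 sg_ge1 e_gt0 e2_gt0 e2_le; lra.

Let eta_gt0 : 0 < eta.
Proof. by rewrite -(pmulr_lgt0 _ sg_gt0) etaE; exact: rise_gt0. Qed.

Let x1_gt0 : 0 < x1. Proof. exact: (foot_inv_gt0 H). Qed.
Let x12 : x1 < x2. Proof. by apply: (foot_inv_incr H) => //; lra_scale. Qed.
Let x2_gt0 : 0 < x2. Proof. exact: lt_trans x12. Qed.
Let sg2_gt0 : 0 < 2 * sg. Proof. by rewrite mulr_gt0. Qed.

Let foot1 : foot x1 = sg. Proof. exact: foot_invK H _ sg_gt0. Qed.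
Let foot2 : foot x2 = 2 * sg. Proof. exact: (foot_invK H). Qed.
Let depth1 : depth x1 = g sg. Proof. exact: (depth_foot_inv H). Qed.
Let depth2 : depth x2 = g (2 * sg). Proof. exact: (depth_foot_inv H). Qed.

Let S1 := x1 - depth x1.
Let S2 := x2 - depth x2.

Let S1_gt0 : 0 < S1. Proof. exact: (gap_gt0 H). Qed.
Let S2_gt0 : 0 < S2. Proof. exact: (gap_gt0 H). Qed.

Let t1_bounds : 0 < g sg <= e ^+ 2 * sg.
Proof.
rewrite -depth1 (depth_gt0 H)//= depth1.
by have := lp_ub H (ltW sg_gt0); rewrite (lp0 H) !subr0.
Qed.

Let t2E : g (2 * sg) = g sg + rise e.
Proof.
have := @treadE sg (2 * sg) (lexx _) _ (lexx _); rewrite ler_peMl ?ler1n// ?ltW//.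
by move=> /(_ isT); rewrite -etaE; lra_scale.
Qed.

Let h1_bounds : e ^+ 2 * sg ^+ 2 / 4 <= sg * g sg - G sg <= e ^+ 2 * sg ^+ 2.
Proof.
have /andP[t0 t1] := t1_bounds; apply/andP; split.
  have h0 := legendre_ge0 H (sg / 2).
  have hs : sg / 2 <= sg by lra_scale.
  by have /andP[+ _] := legendre_homo H hs; rewrite riserE; lra_scale.
have := lpG_ge0 H (ltW sg_gt0); have : sg * g sg <= sg * (e ^+ 2 * sg) by rewrite ler_pM2l.
by lra_scale.
Qed.

Let h2_bounds : sg * rise e <=
  (2 * sg * g (2 * sg) - G (2 * sg)) - (sg * g sg - G sg) <= 2 * sg * rise e.
Proof.
have := @legendre_homo _ _ _ _ _ H sg (2 * sg).
have -> : g (2 * sg) - g sg = rise e by rewrite t2E addrAC subrr add0r.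
by apply; rewrite ler_peMl ?ler1n// ltW.
Qed.

Let S1E : S1 ^+ 2 = g sg ^+ 2 + 2 * (sg * g sg - G sg).
Proof. by rewrite /S1 (gap_sqr H)// foot1 depth1. Qed.

Let S2E : S2 ^+ 2 = g (2 * sg) ^+ 2 + 2 * (2 * sg * g (2 * sg) - G (2 * sg)).
Proof. by rewrite /S2 (gap_sqr H)// foot2 depth2. Qed.

Let S1_sqr_bounds : e ^+ 2 * sg ^+ 2 / 2 <= S1 ^+ 2 <= 9 / 4 * (e ^+ 2 * sg ^+ 2).
Proof.
have /andP[t0 t1] := t1_bounds; have /andP[a b] := h1_bounds.
have t1s : g sg ^+ 2 <= 1 / 4 * (e ^+ 2 * sg ^+ 2).
  apply: (@le_trans _ _ ((e ^+ 2 * sg) ^+ 2)).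
    by rewrite lerXn2r ?nnegrE ?mulr_ge0// ltW.
  have -> : (e ^+ 2 * sg) ^+ 2 = e ^+ 2 * (e ^+ 2 * sg ^+ 2) by ring.
  by rewrite ler_wpM2r// mulr_ge0 ?sqr_ge0.
rewrite S1E; have := sqr_ge0 (g sg); move=> ?; apply/andP; split; lra_scale.
Qed.

Let S1_bounds : 7 / 10 * (e * sg) <= S1 <= 3 / 2 * (e * sg).
Proof.
have /andP[a b] := S1_sqr_bounds; have es : 0 < e * sg by rewrite mulr_gt0.
have esE : (e * sg) ^+ 2 = e ^+ 2 * sg ^+ 2 by rewrite exprMn.
have es2 : 0 < (e * sg) ^+ 2 by rewrite exprn_gt0.
rewrite -esE in a b.
have le_sqr (u v : R) : 0 < u -> 0 < v -> u ^+ 2 <= v ^+ 2 -> u <= v.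
  by move=> u0 v0; rewrite ler_pXn2r// nnegrE ltW.
apply/andP; split; apply: le_sqr; rewrite ?S1_gt0//; try lra_scale;
  rewrite exprMn; lra_scale.
Qed.

Let riseE : rise e = e ^+ 2 / 200. Proof. by []. Qed.

Let sg_sqr : sg <= sg ^+ 2.
Proof. by rewrite expr2 ler_peMl// ltW. Qed.

Let S2_sqr_bounds : S1 ^+ 2 + 2 * (sg * rise e) <= S2 ^+ 2 <= 21 / 20 * S1 ^+ 2.
Proof.
have /andP[t0 t1] := t1_bounds; have /andP[a b] := h2_bounds.
have /andP[c _] := S1_sqr_bounds.
have r0 : 0 < rise e := rise_gt0 e_gt0.
rewrite S2E S1E t2E; rewrite t2E in a b; rewrite S1E in c.
have es : e ^+ 2 * sg <= e ^+ 2 * sg ^+ 2 by rewrite ler_pM2l.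
have q : 2 * g sg * rise e + rise e ^+ 2 <= sg * rise e.
  rewrite expr2 -mulrDl ler_pM2r//.
  have : e ^+ 2 * sg <= 1 / 4 * sg by rewrite ler_pM2r.
  by rewrite riseE; lra_scale.
have q0 : 0 <= 2 * g sg * rise e + rise e ^+ 2.
  by rewrite addr_ge0 ?sqr_ge0// !mulr_ge0// ltW.
have q2 : sg * rise e <= e ^+ 2 * sg ^+ 2 / 200 by rewrite riseE; lra_scale.
by apply/andP; split; lra_scale.
Qed.

Let S2_le : S2 <= 21 / 20 * S1.
Proof.
have /andP[_ a] := S2_sqr_bounds.
rewrite -(ler_pXn2r (n:=2)) ?nnegrE ?mulr_ge0 ?(ltW S1_gt0) ?(ltW S2_gt0)//.
apply: (le_trans a); rewrite exprMn ler_wpM2r ?sqr_ge0//; lra_scale.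
Qed.

(** The gaps satisfy [S2 ^+ 2 - S1 ^+ 2 >= 2 * sg * rise e], of order [e ^+ 2 * sg],
and [S1 + S2] is of order [e * sg]. *)
Lemma tread_width : e / 400 <= x2 - x1.
Proof.
have /andP[a _] := S2_sqr_bounds; have /andP[_ b] := S1_bounds.
have r0 : 0 < rise e := rise_gt0 e_gt0.
have -> : x2 - x1 = S2 - S1 + rise e by rewrite /S1 /S2 depth1 depth2 t2E; ring.
suff : e / 400 <= S2 - S1 by lra_scale.
have es : 0 < e * sg by rewrite mulr_gt0.
have p : 0 < S1 + S2 by rewrite addr_gt0.
rewrite -(ler_pM2r p).
have : e / 400 * (S1 + S2) <= e / 400 * (31 / 10 * (e * sg)).
  apply: ler_wpM2l; first exact: divr_ge0 (ltW e_gt0) (ler0n _ _).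
  by have := S2_le; lra_scale.
move=> h; apply: (le_trans h).
have -> : (S2 - S1) * (S1 + S2) = S2 ^+ 2 - S1 ^+ 2 by ring.
by rewrite riseE in a; have := mulr_gt0 e_gt0 es; lra_scale.
Qed.

Let x1_le : x1 <= sg.
Proof.
have /andP[_ b] := S1_bounds; have /andP[_ t1] := t1_bounds.
have -> : x1 = S1 + g sg by rewrite /S1 depth1 subrK.
have : e ^+ 2 * sg <= 1 / 4 * sg by rewrite ler_pM2r.
have : e * sg <= 1 / 2 * sg by rewrite ler_pM2r.
by lra_scale.
Qed.

Let x2_le : x2 <= 11 / 10 * sg.
Proof.
have /andP[_ b] := S1_bounds; have /andP[_ t1] := t1_bounds.
have -> : x2 = S2 + g (2 * sg) by rewrite /S2 depth2 subrK.
rewrite t2E riseE.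
have : e ^+ 2 * sg <= 1 / 4 * sg by rewrite ler_pM2r.
have : e * sg <= 1 / 2 * sg by rewrite ler_pM2r.
have := S2_le; have := e2_le; have := sg_ge1.
by lra_scale.
Qed.

(** Along the tread the gap [x - depth x] grows by at most a factor [21 / 20], while
[x + foot x] grows from about [sg] to about [2 * sg]; the gap is of order
[e * sg]. *)
Lemma tread_jump :
  e / 10 <= (depth_slope g G x1) - (depth_slope g G x2).
Proof.
have /andP[b _] := S1_bounds.
rewrite /depth_slope foot1 foot2 -/S1 -/S2.
have p1 : 0 < x1 + sg by rewrite addr_gt0.
have p2 : 0 < x2 + 2 * sg by rewrite addr_gt0.
have p3 : 0 < x1 + 2 * sg by rewrite addr_gt0.
have h2 : S2 / (x2 + 2 * sg) <= 21 / 20 * S1 / (x1 + 2 * sg).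
  apply: ler_pM; rewrite ?(ltW S2_gt0) ?invr_ge0 ?(ltW p2)// lef_pV2 ?posrE//.
  by rewrite lerD2r ltW.
suff : e / 10 <= S1 / (x1 + sg) - 21 / 20 * S1 / (x1 + 2 * sg) by lra_scale.
have -> : S1 / (x1 + sg) - 21 / 20 * S1 / (x1 + 2 * sg) =
  S1 * (19 / 20 * sg - x1 / 20) / ((x1 + sg) * (x1 + 2 * sg)).
  by field; rewrite !gt_eqF.
rewrite ler_pdivlMr ?mulr_gt0//.
have q : (x1 + sg) * (x1 + 2 * sg) <= 2 * sg * (3 * sg).
  by apply: ler_pM; rewrite ?(ltW p1) ?(ltW p3)//; have := x1_le; lra_scale.
apply: (@le_trans _ _ (e / 10 * (2 * sg * (3 * sg)))).
  by rewrite ler_pM2l ?divr_gt0.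
apply: (@le_trans _ _ (7 / 10 * (e * sg) * (9 / 10 * sg))).
  have : 0 < e * sg * sg by rewrite !mulr_gt0.
  by lra_scale.
apply: ler_pM => //; rewrite ?mulr_ge0 ?divr_ge0 ?(ltW e_gt0) ?(ltW sg_gt0)//.
by have := x1_le; lra_scale.
Qed.

Lemma tread_foot_bounds (x : R) : x1 < x -> x < x2 -> sg < foot x < 2 * sg.
Proof.
move=> x1x xx2; have x0 := lt_trans x1_gt0 x1x.
by rewrite -{1}foot1 -foot2 !(foot_incr H).
Qed.

Lemma tread_footE (x : R) : x1 < x -> x < x2 ->
  foot x = sg + (depth x - g sg) / eta.
Proof.
move=> x1x xx2; have /andP[a b] := tread_foot_bounds x1x xx2.
have := treadE (lexx _) (ltW a) (ltW b); rewrite -/(depth x) => ->.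
by field; rewrite gt_eqF.
Qed.

(** With [S = x - depth x] and [p = x + foot x], the dominant term of the numerator is
[S ^+ 2 / (p * eta)], of order [e ^+ 2 * sg / eta = 200 * sg ^+ 2]; it is divided by
[p ^+ 2], of order [sg ^+ 2]. *)
Lemma second_slope_ge1 (x : R) : x1 < x -> x < x2 -> 1 <= second_slope g G eta x.
Proof.
move=> x1x xx2; have x_gt0 := lt_trans x1_gt0 x1x.
have /andP[sa sb] := tread_foot_bounds x1x xx2.
have /andP[a _] := S1_sqr_bounds.
rewrite /second_slope /depth_slope.
set s := foot x; set t := depth x; set S := x - t; set p := x + s.
have p0 : 0 < p by rewrite addr_gt0// (lt_trans sg_gt0).
have S0 : 0 < S := gap_gt0 H x_gt0.
have tt : t < g sg + rise e.
  by rewrite -t2E -depth2 (depth_incr H).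
have t1t : g sg < t by rewrite -depth1 (depth_incr H).
have ps : p <= 31 / 10 * sg by have := x2_le; have := xx2; rewrite /p /s; lra_scale.
have SS1 : S1 ^+ 2 <= S ^+ 2.
  rewrite S1E /S /t (gap_sqr H)//; apply: lerD.
    by rewrite lerXn2r ?nnegrE; have /andP[? ?] := t1_bounds; rewrite -/t; lra_scale.
  have /andP[h _] := legendre_homo H (ltW sa).
  rewrite -/(depth x) -/t -/s in h.
  have : 0 <= sg * (t - g sg) by rewrite mulr_ge0 ?subr_ge0// ltW.
  by rewrite -/t -/s; lra_scale.
rewrite ler_pdivlMr ?exprn_gt0// mul1r.
have -> : S * (1 + S / p / eta) - (1 - S / p) * p = S ^+ 2 / (p * eta) + S - (s + t).
  have -> : s + t = p - S by rewrite /p /S; ring.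
  by field; rewrite !gt_eqF.
have st : s + t <= 3 * sg ^+ 2.
  have /andP[_ t1] := t1_bounds.
  have : e ^+ 2 * sg <= 1 / 4 * sg by rewrite ler_pM2r.
  have := riseE; have := sg_sqr; have := e2_le; rewrite /s; lra_scale.
have p2 : p ^+ 2 <= 10 * sg ^+ 2.
  apply: (@le_trans _ _ ((31 / 10 * sg) ^+ 2)).
    by rewrite lerXn2r ?nnegrE ?mulr_ge0 ?divr_ge0 ?(ltW p0) ?(ltW sg_gt0).
  have := sqr_ge0 sg; rewrite exprMn; lra_scale.
suff : 13 * sg ^+ 2 <= S ^+ 2 / (p * eta) by lra_scale.
rewrite ler_pdivlMr ?mulr_gt0//.
apply: le_trans (le_trans a SS1).
have : p * eta <= 31 / 10 * rise e.
  by rewrite -etaE [eta * _]mulrC mulrA ler_pM2r.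
rewrite riseE => h.
have : 13 * sg ^+ 2 * (p * eta) <= 13 * sg ^+ 2 * (31 / 10 * (e ^+ 2 / 200)).
  by rewrite ler_pM2l// mulr_gt0// exprn_gt0.
have : 0 < sg ^+ 2 * e ^+ 2 by rewrite mulr_gt0// exprn_gt0.
lra_scale.
Qed.

Lemma depth_slope_is_derive (x : R) : x1 < x -> x < x2 ->
  is_derive x (1 : R) (fun y => - depth_slope g G y) (second_slope g G eta x).
Proof.
move=> x1x xx2; have x_gt0 := lt_trans x1_gt0 x1x.
have d1 := depth_is_derive H x_gt0.
rewrite -/(depth_slope g G x) in d1.
have d2 : is_derive x (1 : R) foot (depth_slope g G x / eta).
  apply: (@near_eq_is_derive _ R R (fun y => sg + (depth y - g sg) / eta)).
    near=> y; rewrite -tread_footE//; near: y; [exact: lt_nbhsr|exact: lt_nbhsl].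
  by apply: is_derive_eq; rewrite /GRing.scale/=; ring.
have p0 : 0 < x + foot x by rewrite addr_gt0// (foot_gt0 H).
have pN0 : x + foot x != 0 by rewrite gt_eqF.
have d3 : is_derive x (1 : R) (fun y => y - depth y) (1 - depth_slope g G x).
  exact: is_deriveB.
have d4 : is_derive x (1 : R) (fun y => y + foot y) (1 + depth_slope g G x / eta).
  exact: is_deriveD.
have d5 := is_deriveN (is_deriveM d3 (@is_deriveV R (fun y => y + foot y) x _ _ pN0 d4)).
apply: (is_derive_eq d5); rewrite /second_slope /depth_slope /GRing.scale/=.
by field; rewrite pN0 gt_eqF.
Unshelve. all: by end_near. Qed.

End tread.

(** * The variation of the derivative of the peak *)

Section peak_slope.
Context {R : realType}.
Variables (K : nat) (e : R).
Hypotheses (e_gt0 : 0 < e) (e_le : e <= 1 / 2).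

Local Notation ep := (e ^+ 2).
Local Notation drop k := (e ^+ 2 - tread_slope e k).

Definition tread_indic (k : nat) (x : R) : R :=
  step (- 4 ^+ k) x - step (- (2 * 4 ^+ k)) x.

Definition peak_slope (x : R) : R :=
  - 1 + (1 + ep) * step 0 x - \sum_(k < K) drop k * tread_indic k x.

Let drop_bounds k : 0 <= drop k <= ep.
Proof.
by rewrite subr_ge0 tread_slope_le//= gerBl ltW// tread_slope_gt0.
Qed.

Lemma peak_weak_derivative : is_weak_derivative (peak (stair K e) ep) peak_slope.
Proof.
have dN (x : R) : is_derive x (1 : R) (-%R : R -> R) (- 1) by exact: is_deriveNid.
have eN : derive1 (-%R : R -> R) = cst (- 1).
  by apply/funext => x; rewrite derive1E; case: (dN x).
have wN : is_weak_derivative (-%R : R -> R) (cst (- 1)).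
  rewrite -eN; apply: C1_weak_derivative; first by move=> x; case: (dN x).
  by rewrite eN => x; exact: cst_continuous.
have w0 := is_weak_derivativeZ (- (1 + ep)) (ramp_weak_derivative (0 : R)).
have wk k : is_weak_derivative
    (fun x => drop k * (ramp (- 4 ^+ k - x) + -1 * ramp (- (2 * 4 ^+ k) - x)))
    (fun x => drop k * (- step (- 4 ^+ k) x + -1 * - step (- (2 * 4 ^+ k)) x)).
  apply: is_weak_derivativeZ; apply: is_weak_derivativeD; first exact: ramp_weak_derivative.
  by apply: is_weak_derivativeZ; exact: ramp_weak_derivative.
have := is_weak_derivativeD (is_weak_derivativeD wN w0)
  (is_weak_derivative_sum (fun k (_ : (k < K)%N) => wk k)).
congr is_weak_derivative; apply/funext => x.
  rewrite /peak /stair.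
  have -> : ramp x = x + ramp (0 - x).
    by rewrite /ramp; case: (lerP x 0) => ?; case: (lerP (0 - x) 0) => ?; lra.
  rewrite (eq_bigr (fun k : 'I_K => drop k * clamp (4 ^+ k) (2 * 4 ^+ k) (- x))).
    by ring.
  by move=> k _; rewrite /clamp mulN1r; congr (_ * (ramp _ - ramp _)); ring.
rewrite /cst mulrNN /peak_slope -sumrN; congr (_ + _).
by apply: eq_bigr => k _; rewrite /tread_indic; ring.
Qed.

Lemma peak_slope_var : (var peak_slope <= (2 + 2 * K%:R * ep)%:E)%E.
Proof.
have e2 : ep <= 1 by rewrite expr_le1//; [move: e_le; lra|exact: ltW].
have e20 : 0 < ep by rewrite exprn_gt0.
have w0 := var_leD (var_le_cst (- 1 : R)) (var_leZ (1 + ep) (var_le_step (0 : R))).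
have wk k : var_le (fun x => - drop k * (step (- 4 ^+ k) x + -1 * step (- (2 * 4 ^+ k)) x))
    (`|- drop k| * (1 + `|-1| * 1)).
  by apply: var_leZ; apply: var_leD; [|apply: var_leZ]; exact: var_le_step.
have /var_le_var := var_leD w0 (var_le_sum (fun k (_ : (k < K)%N) => wk k)).
rewrite (_ : (fun x => _) = peak_slope); last first.
  apply/funext => x; rewrite /peak_slope -sumrN; congr (_ + _).
  by apply: eq_bigr => k _; rewrite /tread_indic mulN1r mulNr.
move=> /le_trans; apply; rewrite lee_fin add0r mulr1 ger0_norm; last by lra.
apply: lerD; first by lra.
apply: (@le_trans _ _ (\sum_(k < K) 2 * ep)).
  apply: ler_sum => k _; have /andP[d0 d1] := drop_bounds k.
  by rewrite normrN normrN1 ger0_norm//; lra.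
by rewrite sumr_const card_ord -[leLHS]mulr_natl; lra.
Qed.

Lemma step_anti c : {homo step c : x y / x <= y >-> (y <= x :> R)}.
Proof.
move=> x y xy; rewrite /step ler_nat; case: (leP y c) => // yc.
by rewrite (le_trans xy).
Qed.

Lemma step_homo c d (x : R) : c <= d -> step c x <= step d x.
Proof.
move=> cd; rewrite /step ler_nat; case: (leP x c) => // xc.
by rewrite (le_trans xc).
Qed.

Lemma stepT c (x : R) : x <= c -> step c x = 1. Proof. by rewrite /step => ->. Qed.

Lemma stepF c (x : R) : c < x -> step c x = 0. Proof. by rewrite /step leNgt => ->. Qed.

Lemma step_ge0 c (x : R) : 0 <= step c x. Proof. exact: ler0n. Qed.

Lemma step_le1 c (x : R) : step c x <= 1. Proof. by rewrite /step lern1 leq_b1. Qed.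

Lemma tread_indic_ge0 k (x : R) : 0 <= tread_indic k x.
Proof.
have : 0 < 4 ^+ k :> R by rewrite exprn_gt0.
by move=> k0; rewrite subr_ge0 step_homo//; lra.
Qed.

Lemma sum_tread_indic_le1 (x : R) : \sum_(k < K) tread_indic k x <= 1.
Proof.
apply: (@le_trans _ _ (step (- 1) x - step (- 4 ^+ K) x)); last first.
  by have := step_le1 (- 1) x; have := step_ge0 (- 4 ^+ K) x; lra.
elim: K => [|n IH]; first by rewrite big_ord0 expr0 subrr.
rewrite big_ord_recr/= {2}/tread_indic.
have : step (- 4 ^+ n.+1) x <= step (- (2 * 4 ^+ n)) x.
  have : 0 < 4 ^+ n :> R by rewrite exprn_gt0.
  by move=> n0; apply: step_homo; rewrite exprS; lra.
by lra.
Qed.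

Lemma peak_slope_left (x : R) : x <= 0 -> 0 <= peak_slope x <= ep.
Proof.
move=> x0; rewrite /peak_slope stepT// mulr1.
have s0 : 0 <= \sum_(k < K) drop k * tread_indic k x.
  apply: sumr_ge0 => k _; have /andP[d0 d1] := drop_bounds k.
  by rewrite mulr_ge0// tread_indic_ge0.
have s1 : \sum_(k < K) drop k * tread_indic k x <= ep * 1.
  apply: (@le_trans _ _ (ep * \sum_(k < K) tread_indic k x)).
    rewrite mulr_sumr; apply: ler_sum => k _; have /andP[d0 d1] := drop_bounds k.
    by rewrite ler_wpM2r// tread_indic_ge0.
  by rewrite ler_wpM2l ?sqr_ge0// sum_tread_indic_le1.
by apply/andP; split; lra.
Qed.

Lemma peak_slope_right (x : R) : 0 < x -> peak_slope x = - 1.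
Proof.
move=> x0; have st c : c <= 0 -> step c x = 0.
  by move=> c0; rewrite stepF// (le_lt_trans c0).
rewrite /peak_slope st// mulr0 addr0 big1 ?subr0// => k _.
have k0 : 0 < 4 ^+ k :> R by rewrite exprn_gt0.
by rewrite /tread_indic !st ?subrr ?mulr0//; lra.
Qed.

(** The number of corners of the staircase at or to the right of [x], the top of the
peak not included. *)
Definition jump_count (x : R) : R :=
  \sum_(k < K) (step (- 4 ^+ k) x + step (- (2 * 4 ^+ k)) x).

Lemma jump_count_bounds (x : R) : 0 <= jump_count x <= 2 * K%:R.
Proof.
apply/andP; split.
  by apply: sumr_ge0 => k _; rewrite addr_ge0// step_ge0.
apply: (@le_trans _ _ (\sum_(k < K) 2)).
  by apply: ler_sum => k _; have := step_le1 (- 4 ^+ k) x; have := step_le1 (- (2 * 4 ^+ k)) x; lra.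
by rewrite sumr_const card_ord -[leLHS]mulr_natl mulrC.
Qed.

Lemma jump_count_anti (x y : R) : x <= y -> jump_count y <= jump_count x.
Proof. by move=> xy; apply: ler_sum => k _; apply: lerD; exact: step_anti. Qed.

Lemma peak_slope_diff (x y : R) : x <= y -> y <= 0 ->
  `|peak_slope y - peak_slope x| <= ep * (jump_count x - jump_count y).
Proof.
move=> xy y0; rewrite /peak_slope !stepT// ?(le_trans xy)// opprD addrACA subrr add0r opprK.
rewrite addrC -sumrB /jump_count -sumrB mulr_sumr.
apply: le_trans (ler_norm_sum _ _ _) _; apply: ler_sum => k _.
rewrite -mulrBr normrM; have /andP[d0 d1] := drop_bounds k; rewrite ger0_norm//.
apply: ler_pM => //; rewrite /tread_indic ler_norml.
have := step_anti (- 4 ^+ k) xy; have := step_anti (- (2 * 4 ^+ k)) xy => h1 h2.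
by apply/andP; split; lra.
Qed.

(** An increment that crosses the top is at most [2]. Any other increment is at most [ep]
and at most [ep] times the number of corners crossed; after division by [ep] it lies
in [0, 1], where the power [q] only decreases it. *)
Lemma peak_slope_powR (q x y : R) : 1 <= q -> x <= y ->
  `|peak_slope y - peak_slope x| `^ q <=
  2 `^ q * (step 0 x - step 0 y) + ep `^ q * (jump_count x - jump_count y).
Proof.
move=> q1 xy; have q0 : 0 < q := lt_le_trans ltr01 q1.
have e20 : 0 < ep by rewrite exprn_gt0.
have e2 : ep <= 1 by rewrite expr_le1//; [move: e_le; lra|exact: ltW].
have jc : 0 <= jump_count x - jump_count y by rewrite subr_ge0 jump_count_anti.
have [y0|y0] := leP y 0.
  rewrite !stepT// ?(le_trans xy)// subrr mulr0 add0r.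
  set d := `|_|; pose r := d / ep.
  have dE : d = ep * r by rewrite /r mulrC divfK// gt_eqF.
  have r0 : 0 <= r by apply: divr_ge0; [exact: normr_ge0|exact: ltW].
  have r1 : r <= 1.
    rewrite ler_pdivrMr// mul1r /d ler_norml.
    have /andP[a b] := peak_slope_left y0.
    have /andP[a' b'] := peak_slope_left (le_trans xy y0).
    by apply/andP; split; lra.
  have rj : r <= jump_count x - jump_count y.
    by rewrite ler_pdivrMr// mulrC; exact: peak_slope_diff.
  rewrite dE powRM ?(ltW e20)//; apply: ler_wpM2l; first exact: powR_ge0.
  apply: le_trans rj; move: r0; rewrite le_eqVlt => /predU1P[<-|r0].
    by rewrite powR0// gt_eqF.
  by apply: ge1r_powR => //; rewrite r0.
have epq : 0 <= ep `^ q * (jump_count x - jump_count y) by rewrite mulr_ge0// powR_ge0.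
have [x0|x0] := leP x 0; last first.
  rewrite !peak_slope_right// subrr normr0 powR0 ?gt_eqF//.
  by rewrite addr_ge0// mulr_ge0 ?powR_ge0// subr_ge0 step_anti.
have -> : step 0 x - step 0 y = 1.
  by rewrite stepT// stepF// subr0.
have le2 : `|peak_slope y - peak_slope x| <= 2.
  rewrite (peak_slope_right y0) ler_norml.
  have /andP[a b] := peak_slope_left x0.
  by apply/andP; split; lra.
rewrite mulr1 -[leLHS]addr0 lerD// ge0_ler_powR ?nnegrE//.
exact: ltW.
Qed.

Lemma peak_slope_qsum (q : R) (n : nat) (x : nat -> R) : 1 <= q ->
  (forall i, (i < n)%N -> x i < x i.+1) ->
  \sum_(i < n) `|peak_slope (x i.+1) - peak_slope (x i)| `^ q <=
  2 `^ q + ep `^ q * (2 * K%:R).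
Proof.
move=> q1 xn.
apply: (@le_trans _ _ (2 `^ q * (step 0 (x 0%N) - step 0 (x n)) +
    ep `^ q * (jump_count (x 0%N) - jump_count (x n)))).
  elim: n xn => [|n IH] xn; first by rewrite big_ord0 !subrr !mulr0 addr0.
  rewrite big_ord_recr/=.
  have := IH (fun i ni => xn i (ltnW ni)).
  by have := peak_slope_powR q1 (ltW (xn n (ltnSn n))); lra.
have h1 : step 0 (x 0%N) - step 0 (x n) <= 1.
  by have := step_le1 0 (x 0%N); have := step_ge0 0 (x n); lra.
have h2 : jump_count (x 0%N) - jump_count (x n) <= 2 * K%:R.
  have /andP[_ a] := jump_count_bounds (x 0%N).
  by have /andP[b _] := jump_count_bounds (x n); lra.
apply: lerD; last by rewrite ler_wpM2l ?powR_ge0.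
by rewrite ler_piMr ?powR_ge0.
Qed.

End peak_slope.

(** * Bounds for the q-variation and for measures of superlevel sets *)

Lemma approx_continuous_at_continuous {R : realType} (h : R -> R) (x : R) :
  {for x, continuous h} -> approx_continuous_at h x.
Proof.
move=> hc eps eps0; apply: cvg_near_cst.
have /cvgrPdist_lt/(_ _ eps0)[r /= r0 hr] := hc.
near=> d; have d0 : 0 < d by [].
have dr : d <= r by near: d; exact: nbhs_right_le.
have E : ball x d `&` [set y | eps <= `|h y - h x|] = set0.
  apply/seteqP; split => // y [/= xy]; rewrite leNgt => /negP; apply.
  by rewrite distrC; apply: hr => /=; exact: lt_le_trans dr.
by rewrite E /leb measure0 mul0r.
Unshelve. all: by end_near. Qed.

(** The point [x0] makes the supremum nonnegative, hence monotone under the power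
[q^-1]. *)
Lemma varq_le {R : realType} (q B : R) (h : R -> R) (x0 : R) : 1 <= q ->
  approx_continuous_at h x0 ->
  (forall n (x : nat -> R), (forall i, (i < n)%N -> x i < x i.+1) ->
     \sum_(i < n) `|h (x i.+1) - h (x i)| `^ q <= B) ->
  (varq q h <= (B `^ q^-1)%:E)%E.
Proof.
move=> q1 hx0 hB; rewrite /varq -poweR_EFin; set S := ereal_sup _.
have sB : (S <= B%:E)%E.
  by apply: ge_ereal_sup => _ [n [x [_ xn ->]]]; rewrite lee_fin hB.
have s0 : (0 <= S)%E.
  apply: ereal_sup_ubound; exists 0%N, (cst x0); split => //.
  by rewrite big_ord0.
apply: gt0_ler_poweR => //.
- by rewrite invr_ge0 (le_trans ler01).
- by rewrite in_itv/= s0 leey.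
- by rewrite in_itv/= leey andbT (le_trans s0).
Qed.

Lemma varq_ge {R : realType} (q : R) (h : R -> R) (n : nat) (x : nat -> R) : 1 <= q ->
  (forall i, (i <= n)%N -> approx_continuous_at h (x i)) ->
  (forall i, (i < n)%N -> x i < x i.+1) ->
  (((\sum_(i < n) `|h (x i.+1) - h (x i)| `^ q) `^ q^-1)%:E <= varq q h)%E.
Proof.
move=> q1 hx xn; rewrite /varq -poweR_EFin.
set S := ereal_sup _; set s := \sum_(i < n) _.
have sS : (s%:E <= S)%E by apply: ereal_sup_ubound; exists n, x.
have s0 : 0 <= s by apply: sumr_ge0 => i _; exact: powR_ge0.
apply: gt0_ler_poweR => //.
- by rewrite invr_ge0 (le_trans ler01).
- by rewrite in_itv/= lee_fin s0 leey.
- by rewrite in_itv/= leey andbT (le_trans _ sS)// lee_fin.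
Qed.

(** [A] is an arbitrary set: the Lebesgue measure is monotone on all sets, being an
outer measure. *)
Lemma lebesgue_measure_disjoint_ge {R : realType} (n : nat) (I : nat -> set R) (w : R) (A : set R) :
  (forall k, (k < n)%N -> measurable (I k)) ->
  (forall j k, (j < k)%N -> (k < n)%N -> I j `&` I k = set0) ->
  (forall k, (k < n)%N -> (w%:E <= leb (I k))%E) ->
  (forall k, (k < n)%N -> I k `<=` A) ->
  ((n%:R * w)%:E <= leb A)%E.
Proof.
move=> mI dI wI IA.
pose U m := \big[setU/set0]_(k < m) I k.
have main m : (m <= n)%N ->
    [/\ measurable (U m), U m `<=` A & ((m%:R * w)%:E <= leb (U m))%E].
  elim: m => [_|m IH mn].
    by rewrite /U big_ord0 mul0r; split => //; rewrite /leb measure0.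
  have [mU UA wU] := IH (ltnW mn).
  have UE : U m.+1 = U m `|` I m by rewrite /U big_ord_recr.
  rewrite UE; split.
  - by apply: measurableU => //; exact: mI.
  - by rewrite subUset; split => //; exact: IA.
  - have UI : U m `&` I m = set0.
      rewrite /U big_distrl/= big1// => k _; exact: dI.
    rewrite /leb measureU//; last exact: mI.
    by rewrite -natr1 mulrDl mul1r EFinD leeD// wI.
have [_ UA wU] := main n (leqnn n).
apply: (le_trans wU).
exact: (@le_outer_measure _ _ (@lebesgue_measure R)).
Qed.

(** * The maximal function of the staircase peak *)

Section staircase_maximal.
Context {R : realType}.
Variables (K : nat) (e : R).
Hypotheses (e_gt0 : 0 < e) (e_le : e <= 1 / 2).

Local Notation g := (stair K e).
Local Notation G := (stair_prim K e).
Local Notation F := (peak_max g G).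
Local Notation DF := (peak_max_deriv g G (e ^+ 2)).
Local Notation slope := (depth_slope g G).

Let H := stair_profile K e_gt0 e_le.

Let scale_gt0 k : 0 < 4 ^+ k :> R. Proof. by rewrite exprn_gt0. Qed.

Definition tread_start (k : nat) : R := foot_inv g G (4 ^+ k).
Definition tread_end (k : nat) : R := foot_inv g G (2 * 4 ^+ k).

Lemma stair_riserE k :
  g (4 ^+ k) - g (4 ^+ k / 2) = e ^+ 2 * (4 ^+ k - 4 ^+ k / 2).
Proof. by apply: (@stair_riser _ _ _ k) => //; have := scale_gt0 k; lra. Qed.

Lemma tread_start_gt0 k : 0 < tread_start k.
Proof. exact: (foot_inv_gt0 H). Qed.

Lemma tread_start_end k : tread_start k < tread_end k.
Proof. by apply: (foot_inv_incr H) => //; have := scale_gt0 k; lra. Qed.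

Lemma tread_end_start j k : (j < k)%N -> tread_end j < tread_start k.
Proof.
move=> jk; apply: (foot_inv_incr H); first by rewrite mulr_gt0.
by have := scale_lt (R := R) jk; have := scale_gt0 j; lra.
Qed.

Lemma stair_jump k : (k < K)%N -> e / 10 <= slope (tread_start k) - slope (tread_end k).
Proof.
move=> kK; apply: (tread_jump H (eta := tread_slope e k)) => //.
- exact: scale_ge1.
- exact: tread_slopeE.
- exact: stair_riserE.
- by move=> u v; exact: stair_tread.
Qed.

Lemma stair_width k : (k < K)%N -> e / 400 <= tread_end k - tread_start k.
Proof.
move=> kK; apply: (tread_width H (eta := tread_slope e k)) => //.
- exact: scale_ge1.
- exact: tread_slopeE.
- exact: stair_riserE.
- by move=> u v; exact: stair_tread.
Qed.

Lemma stair_superlevel k (x : R) : (k < K)%N -> tread_start k < x -> x < tread_end k ->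
  second_derivative_superlevel F (1 / 2) x.
Proof.
move=> kK ax xb; have x0 := lt_trans (tread_start_gt0 k) ax.
have d2 := depth_slope_is_derive H e_gt0 (scale_ge1 k) (tread_slopeE e k)
  (fun u v => stair_tread e kK) ax xb.
have ge1 := second_slope_ge1 H e_gt0 e_le (scale_ge1 k) (tread_slopeE e k)
  (stair_riserE k) (fun u v => stair_tread e kK) ax xb.
have d1 : \forall y \near x, is_derive y (1 : R) F (- slope y).
  near=> y; apply: peak_max_is_derive_right H _ _.
  by near: y; exact: lt_nbhsr.
have [d3 E] : is_derive x (1 : R) (derive1 F) (second_slope g G (tread_slope e k) x).
  apply: near_eq_is_derive d2; apply: filterS d1 => y [_ <-].
  by rewrite derive1E.
split=> //; first by apply: filterS d1 => y [].
rewrite /derive1n/= derive1E E ger0_norm; lra.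
Unshelve. all: by end_near. Qed.

Lemma stair_weak_L1 :
  ((K%:R * (e / 800))%:E <= weak_L1_second_derivative F)%E.
Proof.
apply: (@le_trans _ _ ((1 / 2)%:E * leb (second_derivative_superlevel F (1 / 2)))%E).
  have -> : K%:R * (e / 800) = 1 / 2 * (K%:R * (e / 400)) by field.
  rewrite EFinM lee_pmul2l//.
  apply: (@lebesgue_measure_disjoint_ge _ _ (fun k => `]tread_start k, tread_end k[%classic)).
  - by move=> k _; exact: measurable_itv.
  - move=> j k jk kK; apply/seteqP; split => // x [] /=; rewrite !in_itv/=.
    move=> /andP[_ xj] /andP[kx _]; have := tread_end_start jk; lra.
  - move=> k kK; rewrite /leb lebesgue_measure_itv/= lte_fin tread_start_end.
    by rewrite -EFinB lee_fin stair_width.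
  - move=> k kK x /=; rewrite in_itv/= => /andP[]; exact: stair_superlevel.
by apply: ereal_sup_ubound; exists (1 / 2) => //=.
Qed.

(** The points at which the passages of the successive treads begin and end. *)
Definition tread_point (i : nat) : R :=
  if odd i then tread_end i./2 else tread_start i./2.

Lemma tread_point_gt0 i : 0 < tread_point i.
Proof.
rewrite /tread_point; case: ifP => _; last exact: tread_start_gt0.
exact: lt_trans (tread_start_gt0 _) (tread_start_end _).
Qed.

Lemma tread_point_incr i : tread_point i < tread_point i.+1.
Proof.
rewrite /tread_point /= uphalf_half; case: (odd i) => /=.
  by rewrite add1n; exact: tread_end_start.
by rewrite add0n; exact: tread_start_end.
Qed.

Lemma peak_max_deriv_approx (x : R) : 0 < x -> approx_continuous_at DF x.
Proof.
move=> x0; apply: approx_continuous_at_continuous.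
rewrite /prop_for /continuous_at (peak_max_derivE H x0).
apply: (cvg_trans (near_eq_cvg _)); last by apply: cvgN; exact: depth_slope_cont H _ x0.
near=> y; rewrite (peak_max_derivE H)//; near: y; exact: lt_nbhsr.
Unshelve. all: by end_near. Qed.

Lemma stair_varq (q : R) : 1 <= q ->
  (((K%:R * (e / 10) `^ q) `^ q^-1)%:E <= varq q DF)%E.
Proof.
move=> q1; have q0 : 0 < q := lt_le_trans ltr01 q1.
apply: (le_trans _ (varq_ge q1 (n := K.*2) (x := tread_point) _ _)); last first.
- by move=> i _; exact: tread_point_incr.
- by move=> i _; apply: peak_max_deriv_approx; exact: tread_point_gt0.
have sum_ge n : (n <= K)%N -> n%:R * (e / 10) `^ q <=
    \sum_(i < n.*2) `|DF (tread_point i.+1) - DF (tread_point i)| `^ q.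
  elim: n => [_|n IH nK]; first by rewrite mul0r big_ord0.
  rewrite doubleS !big_ord_recr/= -addrA.
  rewrite -natr1 mulrDl mul1r; apply: lerD; first exact/IH/ltnW.
  rewrite -[leLHS]addr0; apply: lerD; last exact: powR_ge0.
  apply: ge0_ler_powR; rewrite ?nnegrE ?(ltW q0) ?divr_ge0 ?(ltW e_gt0)//.
  rewrite !(peak_max_derivE H) ?tread_point_gt0//.
  rewrite opprK addrC /tread_point/= odd_double/= uphalf_double doubleK.
  exact: le_trans (stair_jump nK) (ler_norm _).
rewrite lee_fin; apply: ge0_ler_powR; rewrite ?nnegrE ?invr_ge0 ?(ltW q0)//.
- by rewrite mulr_ge0 ?powR_ge0.
- by apply: sumr_ge0 => i _; exact: powR_ge0.
- exact: sum_ge.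
Qed.

Lemma peak_slope_varq (q : R) : 1 <= q ->
  (varq q (peak_slope K e) <=
   ((2 `^ q + (e ^+ 2) `^ q * (2 * K%:R)) `^ q^-1)%:E)%E.
Proof.
move=> q1; apply: (@varq_le _ _ _ _ 1) => //.
  apply: approx_continuous_at_continuous.
  rewrite /prop_for /continuous_at peak_slope_right//.
  apply: cvg_near_cst; near=> y; rewrite peak_slope_right//.
  by near: y; exact: lt_nbhsr.
by move=> n x; exact: peak_slope_qsum.
Unshelve. all: by end_near. Qed.

End staircase_maximal.

(** [e] is chosen first, so small that the terms with [K * e ^+ 2] and [K * (e ^+ 2) `^ q]
on the left use up at most half of the right hand sides; then [K] is chosen so large
that the other half exceeds the remaining terms. *)
Lemma staircase_constants {R : realType} (q C : R) : 1 <= q -> 0 < C ->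
  exists (K : nat) (e : R), [/\ 0 < e, e <= 1 / 2,
    C * (2 + 2 * K%:R * e ^+ 2) < K%:R * (e / 800) &
    C `^ q * (2 `^ q + (e ^+ 2) `^ q * (2 * K%:R)) < K%:R * (e / 10) `^ q].
Proof.
move=> q1 C0; have q0 : 0 < q := lt_le_trans ltr01 q1.
(* With this factor, [2 * C * e ^+ 2] is at most half of [e / 800]. *)
have [c c0 cE] : exists2 c : R, 0 < c & c = 3200 by exists 3200; rewrite ?ltr0n.
pose e := Num.min (1 / 2) (c * C)^-1.
have cC0 : 0 < c * C by exact: mulr_gt0.
have e0 : 0 < e by rewrite lt_min divr_gt0 ?invr_gt0.
have e12 : e <= 1 / 2 by rewrite ge_min lexx.
have eC : c * C * e <= 1.
  have : e <= (c * C)^-1 by rewrite ge_min lexx orbT.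
  by rewrite -(ler_pM2l cC0) mulfV ?gt_eqF.
have eq0 : 0 < (e / 10) `^ q by rewrite powR_gt0// divr_gt0.
pose B := Num.max (c * C / e) (2 * (C `^ q * 2 `^ q) / (e / 10) `^ q).
have /archi_boundP : 0 <= B.
  by rewrite le_max; apply/orP; left; apply: divr_ge0; exact: ltW.
set K := Num.bound B => BK.
exists K, e; split; [exact: e0|exact: e12| |].
- have : c * C / e < K%:R by apply: le_lt_trans BK; rewrite le_max lexx.
  rewrite ltr_pdivrMr// => h.
  have : c * C * e * (K%:R * e) <= 1 * (K%:R * e).
    by apply: ler_wpM2r eC; apply: mulr_ge0; [exact: ler0n|exact: ltW].
  by rewrite cE in h *; lra.
- have : 2 * (C `^ q * 2 `^ q) / (e / 10) `^ q < K%:R.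
    by apply: le_lt_trans BK; rewrite le_max lexx orbT.
  rewrite ltr_pdivrMr// => h.
  have key : C `^ q * (e ^+ 2) `^ q * 4 <= (e / 10) `^ q.
    rewrite -powRM ?(ltW C0) ?sqr_ge0//.
    have -> : C * e ^+ 2 = (10 * C * e) * (e / 10) by field.
    have r0 : 0 < 10 * C * e by rewrite !mulr_gt0.
    have r1 : 10 * C * e <= 1 / 4 by rewrite cE in eC; lra.
    have r2 : 10 * C * e <= 1 by lra.
    rewrite powRM ?(ltW r0) ?divr_ge0 ?(ltW e0)//.
    have : (10 * C * e) `^ q <= 1 / 4.
      apply: le_trans r1; apply: ge1r_powR q1; apply/andP; split; [exact: r0|exact: r2].
    move=> h1; have : (10 * C * e) `^ q * (e / 10) `^ q <= 1 / 4 * (e / 10) `^ q.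
      by apply: ler_wpM2r h1; exact: ltW.
    by lra.
  have : C `^ q * (e ^+ 2) `^ q * 4 * K%:R <= (e / 10) `^ q * K%:R by rewrite ler_wpM2r.
  lra.
Qed.

Theorem theorem1p1 (R : realType) (q C : R) (hq : 1 <= q) (hC : 0 < C) :
  exists f f' Mf Mf' : R -> R,
    (continuous f /\ is_weak_derivative f f') /\
    (exists! x : R, local_maximum f x) /\
    ((forall x : R, uncentered_maximal f x = (Mf x)%:E) /\
     is_weak_derivative Mf Mf') /\
    (C%:E * var f' < weak_L1_second_derivative Mf)%E /\
    (C%:E * varq q f' < varq q Mf')%E.
Proof.
have [K [e [e_gt0 e_le weak_const varq_const]]] := staircase_constants hq hC.
have H := stair_profile K e_gt0 e_le.
have q0 : 0 < q := lt_le_trans ltr01 hq.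
exists (peak (stair K e) (e ^+ 2)), (peak_slope K e),
  (peak_max (stair K e) (stair_prim K e)),
  (peak_max_deriv (stair K e) (stair_prim K e) (e ^+ 2)).
split; [|split; [|split; [|split]]].
- by split; [exact: peak_cont H|exact: peak_weak_derivative].
- exists 0; split; first exact/(peak_local_maximum H).
  by move=> x /(peak_local_maximum H).
- by split; [exact: peak_maxE H|exact: peak_max_weak_derivative H].
- apply: lt_le_trans (stair_weak_L1 K e_gt0 e_le).
  apply: (@le_lt_trans _ _ (C%:E * (2 + 2 * K%:R * e ^+ 2)%:E)%E).
    by rewrite lee_pmul2l// peak_slope_var.
  by rewrite -EFinM lte_fin.
- apply: lt_le_trans (stair_varq K e_gt0 e_le hq).
  set B := 2 `^ q + (e ^+ 2) `^ q * (2 * K%:R) in varq_const.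
  have B0 : 0 <= B by rewrite addr_ge0 ?mulr_ge0 ?powR_ge0.
  apply: (@le_lt_trans _ _ (C%:E * (B `^ q^-1)%:E)%E).
    by rewrite lee_pmul2l// peak_slope_varq.
  rewrite -EFinM lte_fin.
  have -> : C * B `^ q^-1 = (C `^ q * B) `^ q^-1.
    by rewrite powRM ?powR_ge0// -powRrM divff ?gt_eqF// powRr1// ltW.
  apply: gt0_ltr_powR => //; rewrite ?invr_gt0// nnegrE mulr_ge0 ?powR_ge0//.
Qed.
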